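(* Let $n\ge 2$ and let $\Sigma^{n} \subset \mathbb{R}^{n+1}$ be a complete, embedded minimal hypersurface such that $\sup_{\Sigma}|A|^2 < \infty$. Then $\Sigma$ is unbounded, i.e. $\Sigma$ is not contained in any Euclidean ball of $\mathbb{R}^{n+1}$.
   Context: $|A|$ is the norm of the second fundamental form of $\Sigma$. Complete means that $\Sigma$ with the induced Riemannian metric is a complete Riemannian manifold (without boundary). Embedded means without self-intersections (properness is not assumed). Minimal means zero mean curvature. *)

(* Defs.v *)
From HB Require Import structures.
From mathcomp Require Import all_boot all_order all_algebra.
From mathcomp Require Import all_classical all_reals all_analysis.

Set Implicit Arguments.
Unset Strict Implicit.
Unset Printing Implicit Defensive.

Import Order.TTheory GRing.Theory Num.Theory.
Import numFieldNormedType.Exports.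

Local Open Scope classical_set_scope.
Local Open Scope ring_scope.

(* The library norm on 'rV[R]_m is the sup norm; it is used for topology and
   differentiation only.  Lengths and balls use the Euclidean norm below. *)
Definition dot (R : realType) (m : nat) (u v : 'rV[R]_m) : R :=
  (u *m v^T) 0 0.

Definition enorm (R : realType) (m : nat) (u : 'rV[R]_m) : R :=
  Num.sqrt (dot u u).

Definition eball (R : realType) (m : nat) (a : 'rV[R]_m) (r : R) :
    set 'rV[R]_m :=
  [set y | enorm (y - a) < r].

Definition partial (R : realType) (n m : nat) (i : 'I_n)
    (f : 'rV[R]_n -> 'rV[R]_m) : 'rV[R]_n -> 'rV[R]_m :=
  'D_(delta_mx 0 i) f.

(* Meant for open U. *)
Fixpoint Ck_on (R : realType) (n m k : nat) (U : set 'rV[R]_n)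
    (f : 'rV[R]_n -> 'rV[R]_m) : Prop :=
  if k is k'.+1 then
    (forall x, U x -> differentiable f x) /\
    (forall i : 'I_n, Ck_on k' U (partial i f))
  else forall x, U x -> {for x, continuous f}.

Definition smooth_on (R : realType) (n m : nat) (U : set 'rV[R]_n)
    (f : 'rV[R]_n -> 'rV[R]_m) : Prop :=
  forall k, Ck_on k U f.

(* A homeomorphism from an open set of M onto an open set of R^n; the values of
   cmap outside cdom and of cinv outside ccod are irrelevant. *)
Record chart (R : realType) (n : nat) (M : topologicalType) := Chart {
  cdom : set M;
  ccod : set 'rV[R]_n;
  cmap : M -> 'rV[R]_n;
  cinv : 'rV[R]_n -> M;
  cdom_open : open cdom;
  ccod_open : open ccod;
  cmap_cod : forall p, cdom p -> ccod (cmap p);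
  cinv_dom : forall x, ccod x -> cdom (cinv x);
  cmapK : forall p, cdom p -> cinv (cmap p) = p;
  cinvK : forall x, ccod x -> cmap (cinv x) = x;
  cmap_continuous : forall p, cdom p -> {for p, continuous cmap};
  cinv_continuous : forall x, ccod x -> {for x, continuous cinv} }.

(* Smooth n-manifold without boundary, not necessarily connected. *)
Record manifold (R : realType) (n : nat) := Manifold {
  carrier :> topologicalType;
  carrier_hausdorff : hausdorff_space carrier;
  carrier_second_countable : @second_countable carrier;
  atlas : set (chart R n carrier);
  atlas_cover : forall p, exists2 c, atlas c & cdom c p;
  atlas_compatible : forall c d, atlas c -> atlas d ->
    smooth_on (ccod c `&` cinv c @^-1` cdom d) (cmap d \o cinv c) }.

Section Hypersurface.
Variables (R : realType) (n : nat) (M : manifold R n).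
Variable F : M -> 'rV[R]_n.+1.

Definition immersion : Prop :=
  forall c, atlas c ->
    smooth_on (ccod c) (F \o cinv c) /\
    (forall x, ccod c x -> row_free ('J (F \o cinv c) x)).

(* No self-intersections.  F need not be proper, nor a homeomorphism onto its
   image with the subspace topology: the hypersurface may accumulate on
   itself. *)
Definition embedded_hypersurface : Prop := immersion /\ injective F.

End Hypersurface.

Section LocalGeometry.
Variables (R : realType) (n : nat).
Variable X : 'rV[R]_n -> 'rV[R]_n.+1.

(* Row i of 'J X x is the i-th partial derivative of X, so this is the matrix
   g_ij = <d_i X, d_j X>. *)
Definition first_form (x : 'rV[R]_n) : 'M[R]_n := 'J X x *m ('J X x)^T.

Definition normal_part (x : 'rV[R]_n) (v : 'rV[R]_n.+1) : 'rV[R]_n.+1 :=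
  v - v *m ('J X x)^T *m invmx (first_form x) *m 'J X x.

(* The normal-vector-valued form A(d_i, d_j) = (d_i d_j X)^normal = h_ij N;
   unlike h_ij it needs no choice of a unit normal N. *)
Definition second_form (x : 'rV[R]_n) (i j : 'I_n) : 'rV[R]_n.+1 :=
  normal_part x (partial i (partial j X) x).

(* g^ik g^jl <A_ij, A_kl> *)
Definition second_form_sqnorm (x : 'rV[R]_n) : R :=
  \sum_i \sum_j \sum_k \sum_l
    invmx (first_form x) i k * invmx (first_form x) j l *
    dot (second_form x i j) (second_form x k l).

(* g^ij A_ij, that is H N with H the trace of the shape operator. *)
Definition mean_curvature (x : 'rV[R]_n) : 'rV[R]_n.+1 :=
  \sum_i \sum_j invmx (first_form x) i j *: second_form x i j.

End LocalGeometry.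

Section GlobalGeometry.
Variables (R : realType) (n : nat) (M : manifold R n).
Variable F : M -> 'rV[R]_n.+1.

Definition minimal : Prop :=
  forall c x, atlas c -> ccod c x -> mean_curvature (F \o cinv c) x = 0.

(* Both |A|^2 and the vanishing of the mean curvature are independent of the
   chart. *)
Definition sup_sqnorm_A : \bar R :=
  ereal_sup [set a | exists c x, [/\ @atlas R n M c, ccod c x &
    a = (second_form_sqnorm (F \o cinv c) x)%:E]].

(* C^1 curves on the compact interval [0, 1], i.e. restrictions of curves that
   are C^1 on a neighbourhood of it. *)
Definition C1_arc (g : R -> M) : Prop :=
  exists2 e : R, 0 < e & forall t : R, - e < t < 1 + e ->
    {for t, continuous g} /\
    (forall c, atlas c -> cdom c (g t) ->
      derivable (cmap c \o g) t 1 /\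
      {for t, continuous (derive1 (cmap c \o g))}).

(* In the metric induced by F the speed of g is the Euclidean norm of
   dF(g') = (F o g)'. *)
Definition arc_length (g : R -> M) : R :=
  \int[@lebesgue_measure R]_(t in `[0, 1]) enorm (derive1 (F \o g) t).

(* pw_C1_path p q l: a piecewise C^1 curve of length l, given as a finite
   concatenation of C^1 arcs, joins p to q. *)
Inductive pw_C1_path : M -> M -> R -> Prop :=
| pw_C1_nil p : pw_C1_path p p 0
| pw_C1_cons g q l : C1_arc g -> pw_C1_path (g 1) q l ->
    pw_C1_path (g 0) q (arc_length g + l).

(* Riemannian distance of the induced metric; +oo between points of different
   components. *)
Definition riemannian_dist (p q : M) : \bar R :=
  ereal_inf [set l%:E | l in pw_C1_path p q].

Definition complete_hypersurface : Prop :=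
  forall u : nat -> M,
    (forall e : R, 0 < e -> exists N, forall i j, (N <= i)%N -> (N <= j)%N ->
       (riemannian_dist (u i) (u j) < e%:E)%E) ->
    exists p, forall e : R, 0 < e -> exists N, forall i, (N <= i)%N ->
       (riemannian_dist (u i) p < e%:E)%E.

End GlobalGeometry.

(* Main.v *)
Require Import Defs.
From HB Require Import structures.
From mathcomp Require Import all_boot all_order all_algebra.
From mathcomp Require Import all_classical all_reals all_analysis.
From mathcomp Require Import ring lra.
Import Order.TTheory GRing.Theory Num.Theory.
Import numFieldNormedType.Exports.
Local Open Scope classical_set_scope.
Local Open Scope ring_scope.

(* Fix p0 with unit normal nu and let f be the orthogonal projection of F onto
   the hyperplane nu^perp.  Since |A| is bounded, the tangent planes are nearly
   orthogonal to nu on an intrinsic ball about p0 of a radius r0 independent of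
   p0, so f is almost isometric to first order there.  Completeness and
   Ekeland's variational principle then show that f covers Euclidean balls of
   uniform size, and repeatedly shortening a pair of points with the same image
   shows that f is injective on a smaller ball.  Hence the part of the
   hypersurface over a closed ball of radius rho = r0 / 64 in nu^perp is compact.

   If F were bounded, choose p0 with |F p0 - a|^2 > sup |F - a|^2 - rho^2 / 2.
   Over that compact ball |F - a|^2 - |F - F p0|^2 / 2 has a maximum, which is
   interior by the choice of p0.  By minimality the Laplacian of this function is
   2 n (1 - 1 / 2) > 0, a contradiction.  No geodesics and no curvature
   comparison are needed. *)

(** * Euclidean norm *)

Section Euclidean.
Context {R : realType} {m : nat}.
Implicit Types (u v w : 'rV[R]_m) (k : R).

Lemma dotE u v : dot u v = \sum_i u 0 i * v 0 i.
Proof. by rewrite /dot mxE; apply: eq_bigr => i _; rewrite mxE. Qed.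

Lemma dotC u v : dot u v = dot v u.
Proof. by rewrite !dotE; apply: eq_bigr => i _; rewrite mulrC. Qed.

Lemma dotDl u v w : dot (u + v) w = dot u w + dot v w.
Proof. by rewrite /dot mulmxDl mxE. Qed.

Lemma dotZl k u v : dot (k *: u) v = k * dot u v.
Proof. by rewrite /dot -scalemxAl mxE. Qed.

Lemma dotDr u v w : dot w (u + v) = dot w u + dot w v.
Proof. by rewrite dotC dotDl !(dotC _ w). Qed.

Lemma dotZr k u v : dot u (k *: v) = k * dot u v.
Proof. by rewrite dotC dotZl dotC. Qed.

Lemma dotNl u v : dot (- u) v = - dot u v.
Proof. by rewrite -scaleN1r dotZl mulN1r. Qed.

Lemma dotNr u v : dot u (- v) = - dot u v.
Proof. by rewrite dotC dotNl dotC. Qed.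

Lemma dotBl u v w : dot (u - v) w = dot u w - dot v w.
Proof. by rewrite dotDl dotNl. Qed.

Lemma dotBr u v w : dot w (u - v) = dot w u - dot w v.
Proof. by rewrite dotDr dotNr. Qed.

Lemma dot0l v : dot 0 v = 0.
Proof. by rewrite -(scale0r v) dotZl mul0r. Qed.

Lemma dot_suml (I : finType) (f : I -> 'rV[R]_m) v :
  dot (\sum_i f i) v = \sum_i dot (f i) v.
Proof.
rewrite /dot mulmx_suml summxE.
by apply: eq_bigr.
Qed.

Lemma dot_ge0 u : 0 <= dot u u.
Proof. by rewrite dotE; apply: sumr_ge0 => i _; rewrite -expr2 sqr_ge0. Qed.

Lemma dot_eq0 u : dot u u = 0 -> u = 0.
Proof.
rewrite dotE => /eqP; rewrite psumr_eq0; last first.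
  by move=> i _; rewrite -expr2 sqr_ge0.
move=> /allP u0; apply/rowP => i; rewrite mxE.
have /implyP := u0 i (mem_index_enum i).
by rewrite -expr2 sqrf_eq0 => /(_ isT)/eqP.
Qed.

Lemma sqr_enorm u : enorm u ^+ 2 = dot u u.
Proof. by rewrite /enorm sqr_sqrtr// dot_ge0. Qed.

Lemma enorm_ge0 u : 0 <= enorm u.
Proof. exact: sqrtr_ge0. Qed.

Lemma enorm_eq0 u : enorm u = 0 -> u = 0.
Proof. by move=> u0; apply: dot_eq0; rewrite -sqr_enorm u0 expr0n. Qed.

Lemma enorm0 : enorm (0 : 'rV[R]_m) = 0.
Proof. by rewrite /enorm dot0l sqrtr0. Qed.

Lemma enorm_gt0 u : u != 0 -> 0 < enorm u.
Proof.
move=> u0; rewrite lt_def enorm_ge0 andbT.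
by apply: contra u0 => /eqP/enorm_eq0 ->.
Qed.

Lemma dot_le_enorm u v : dot u v <= enorm u * enorm v.
Proof.
have [->|u0] := eqVneq u 0; first by rewrite dot0l mulr_ge0 ?enorm_ge0.
have [->|v0] := eqVneq v 0; first by rewrite dotC dot0l mulr_ge0 ?enorm_ge0.
have := enorm_gt0 _ u0; have := enorm_gt0 _ v0.
have := dot_ge0 (enorm v *: u - enorm u *: v).
rewrite dotBl !dotBr !dotZl !dotZr -!sqr_enorm (dotC v u).
move: (enorm u) (enorm v) (dot u v) => a b d h b0 a0.
have ab0 : 0 < a * b by rewrite mulr_gt0.
have : 0 <= 2 * (a * b) * (a * b - d) by nra.
by rewrite pmulr_rge0 ?subr_ge0// mulr_gt0.
Qed.

Lemma normr_dot_le u v : `|dot u v| <= enorm u * enorm v.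
Proof.
rewrite ler_norml dot_le_enorm andbT lerNl -dotNl.
by rewrite (le_trans (dot_le_enorm _ _))// /enorm dotNl dotNr opprK.
Qed.

Lemma enormD u v : enorm (u + v) <= enorm u + enorm v.
Proof.
rewrite -(@ler_pXn2r _ 2)// ?nnegrE ?addr_ge0 ?enorm_ge0//.
rewrite sqr_enorm dotDl !dotDr sqrrD !sqr_enorm (dotC v u).
have := dot_le_enorm u v; lra.
Qed.

Lemma enormN u : enorm (- u) = enorm u.
Proof. by rewrite /enorm dotNl dotNr opprK. Qed.

Lemma enormBC u v : enorm (u - v) = enorm (v - u).
Proof. by rewrite -enormN opprB. Qed.

Lemma enorm_triangle w u v : enorm (u - v) <= enorm (u - w) + enorm (w - v).
Proof. by rewrite (le_trans _ (enormD _ _))// addrA subrK. Qed.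

Lemma enormB u v : enorm u - enorm v <= enorm (u - v).
Proof. by rewrite lerBlDr -{1}(subrK v u) enormD. Qed.

Lemma enormZ k u : enorm (k *: u) = `|k| * enorm u.
Proof.
by rewrite /enorm dotZl dotZr mulrA -expr2 sqrtrM ?sqr_ge0// sqrtr_sqr.
Qed.

Lemma normr_coord_le u i : `|u 0 i| <= `|u|.
Proof.
rewrite {2}/Num.Def.normr/= mx_normrE.
exact: (le_bigmax _ (fun ij : 'I_1 * 'I_m => `|u ij.1 ij.2|) (0, i)).
Qed.

Lemma normr_le_enorm u : `|u| <= enorm u.
Proof.
rewrite {1}/Num.Def.normr/= mx_normrE; apply: bigmax_le; first exact: enorm_ge0.
move=> [i j] _ /=; rewrite ord1 -sqrtr_sqr ler_wsqrtr// dotE (bigD1 j)//= -expr2.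
by rewrite lerDl sumr_ge0// => k _; rewrite -expr2 sqr_ge0.
Qed.

Lemma enorm_le_normr u : enorm u <= m%:R * `|u|.
Proof.
rewrite -(@ler_pXn2r _ 2)// ?nnegrE ?mulr_ge0 ?enorm_ge0//.
rewrite sqr_enorm dotE.
apply: (@le_trans _ _ (\sum_(i < m) `|u| ^+ 2)).
  apply: ler_sum => i _; rewrite -expr2 -real_normK ?num_real//.
  by rewrite ler_pXn2r// ?nnegrE// normr_coord_le.
rewrite sumr_const card_ord -[leLHS]mulr_natl exprMn ler_wpM2r ?sqr_ge0//.
case: m => [|k]; first by rewrite expr0n.
by rewrite expr2 ler_peMl// ler1n.
Qed.

Lemma enorm_unit u : u != 0 -> enorm ((enorm u)^-1 *: u) = 1.
Proof.
move=> u0; rewrite enormZ ger0_norm ?invr_ge0 ?enorm_ge0// mulVf//.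
by rewrite gt_eqF ?enorm_gt0.
Qed.

Lemma enorm_le_dot u (K : R) :
  (forall w, enorm w = 1 -> dot u w <= K) -> 0 <= K -> enorm u <= K.
Proof.
move=> h K0; have [->|u0] := eqVneq u 0; first by rewrite enorm0.
have := h _ (enorm_unit _ u0); rewrite dotZr -sqr_enorm expr2 mulrA mulVf ?mul1r//.
by rewrite gt_eqF ?enorm_gt0.
Qed.

End Euclidean.

Lemma dot_mulmx {R : realType} {m n : nat} (u : 'rV[R]_m) (A : 'M[R]_(m, n))
  (v : 'rV[R]_n) : dot (u *m A) v = dot u (v *m A^T).
Proof. by rewrite /dot trmx_mul trmxK mulmxA. Qed.

Lemma enorm_mulmx_le {R : realType} {m n : nat} (A : 'M[R]_(m, n)) :
  exists2 K : R, 0 < K & forall u : 'rV[R]_m, enorm (u *m A) <= K * `|u|.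
Proof.
exists (1 + \sum_i enorm (row i A)).
  by rewrite ltr_wpDr// sumr_ge0// => i _; exact: enorm_ge0.
move=> u; apply: (@le_trans _ _ ((\sum_i enorm (row i A)) * `|u|)); last first.
  by rewrite ler_wpM2r// lerDr.
have -> : u *m A = \sum_i u 0 i *: row i A.
  by rewrite mulmx_sum_row.
rewrite mulr_suml; elim/big_ind2 : _ => [|x a y b xa yb|i _].
- by rewrite enorm0.
- by rewrite (le_trans (enormD _ _))// lerD.
- by rewrite enormZ mulrC ler_wpM2l ?enorm_ge0// normr_coord_le.
Qed.

(** * Complete length structures *)

Lemma near_dist_lt {R : realType} {m : nat} (u : 'rV[R]_m) (e : R) :
  0 < e -> \forall v \near u, `|u - v| < e.
Proof.
by move=> e0; apply: filterS (nbhsx_ballx u e e0) => v; rewrite -ball_normE.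
Qed.

Lemma enormB_continuous {R : realType} {m : nat} (c : 'rV[R]_m) :
  continuous (fun b : 'rV[R]_m => enorm (b - c)).
Proof.
move=> u; apply/(@cvgrPdist_le _ _ _ (nbhs u) (nbhs_filter u)) => e e0.
have d0 : 0 < e / m.+1%:R by rewrite divr_gt0// ltr0n.
apply: filterS (near_dist_lt u _ d0) => v /ltW vu.
have uv : enorm (u - v) <= e.
  rewrite (le_trans (enorm_le_normr _))//.
  rewrite (@le_trans _ _ (m%:R * (e / m.+1%:R)))// ?ler_wpM2l//.
  have m1 : m%:R / m.+1%:R <= 1 :> R.
    by rewrite ler_pdivrMr ?ltr0n// mul1r ler_nat.
  by rewrite mulrCA; apply: ler_piMr => //; exact: ltW.
rewrite ler_norml; apply/andP; split.
  rewrite lerNl opprB lerBlDr (le_trans (enorm_triangle u _ _))// lerD2r.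
  by rewrite enormBC.
by rewrite lerBlDr (le_trans (enorm_triangle v _ _))// lerD2r.
Qed.

Lemma dotl_continuous {R : realType} {m : nat} (w : 'rV[R]_m) :
  continuous (fun u : 'rV[R]_m => dot u w).
Proof.
move=> u; have -> : (fun u : 'rV[R]_m => dot u w) = (fun u => \sum_i u 0 i * w 0 i).
  by apply/funext => v; rewrite dotE.
apply: (@cvg_big _ _ _ _ _ add_continuous _ (nbhs u) _ _ _ (nbhs_filter u)) => i _.
by apply: (@cvgM _ _ _ (nbhs_filter u)); [exact: coord_continuous|exact: cvg_cst].
Qed.

(* [C x y l] reads: some path of length at most [l] joins [x] to [y]. *)
Record complete_length_structure {R : realType} {T : Type}
    (C : T -> T -> R -> Prop) : Prop := {
  len_refl : forall x, C x x 0;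
  len_ge0 : forall x y l, C x y l -> 0 <= l;
  len_sym : forall x y l, C x y l -> C y x l;
  len_le : forall x y l l', C x y l -> l <= l' -> C x y l';
  len_trans : forall x y z l l', C x y l -> C y z l' -> C x z (l + l');
  len_split : forall x y l s, C x y l -> 0 <= s <= l ->
    exists2 w, C x w s & C w y (l - s);
  len_complete : forall u : nat -> T,
    (forall e, 0 < e -> exists N, forall i j,
      (N <= i)%N -> (N <= j)%N -> C (u i) (u j) e) ->
    exists p, forall e, 0 < e -> exists N, forall i, (N <= i)%N -> C (u i) p e }.

Arguments len_refl {R T C}.
Arguments len_ge0 {R T C} _ {x y l}.
Arguments len_sym {R T C} _ {x y l}.
Arguments len_le {R T C} _ {x y l l'}.
Arguments len_trans {R T C} _ {x y z l l'}.
Arguments len_split {R T C} _ {x y l}.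
Arguments len_complete {R T C}.

Lemma decreasing_ge0_cauchy {R : realType} (phi : nat -> R) :
  (forall k, 0 <= phi k) -> (forall k, phi k.+1 <= phi k) ->
  forall e, 0 < e -> exists N, forall i j, (N <= i)%N -> (N <= j)%N ->
    phi i - phi j < e.
Proof.
move=> phi0 dphi e e0.
have phile i j : (i <= j)%N -> phi j <= phi i.
  move=> /subnK <-; elim: (j - i)%N => // k ih.
  by rewrite addSn (le_trans (dphi _)).
have infphi : has_inf (range phi).
  by split; [exists (phi 0%N), 0%N|exists 0 => _ [k _ <-]].
have [_ [N _ <-] hN] := inf_adherent e0 infphi.
exists N => i j Ni Nj.
rewrite ltrBlDr (le_lt_trans (phile _ _ Ni))// (lt_le_trans hN)// addrC lerD2l.
by apply: ge_inf; [case: infphi|exists j].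
Qed.

Section LengthStructure.
Context {R : realType} {T : Type} {C : T -> T -> R -> Prop}.
Hypothesis CL : complete_length_structure C.

Lemma descending_chain (u : nat -> T) (phi : nat -> R) i j :
  (forall k, C (u k) (u k.+1) (phi k - phi k.+1)) -> (i <= j)%N ->
  C (u i) (u j) (phi i - phi j).
Proof.
move=> hu /subnK <-; elim: (j - i)%N => [|k ih].
  by rewrite add0n subrr; exact: (len_refl CL).
have := len_trans CL ih (hu _); rewrite addrA subrK.
by rewrite addSn.
Qed.

Lemma descending_limit (u : nat -> T) (phi : nat -> R) :
  (forall k, 0 <= phi k) ->
  (forall k, C (u k) (u k.+1) (phi k - phi k.+1)) ->
  exists p, forall e, 0 < e -> exists N, forall i, (N <= i)%N -> C (u i) p e.
Proof.
move=> phi0 hu.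
have dphi k : phi k.+1 <= phi k by have := len_ge0 CL (hu k); rewrite subr_ge0.
apply: (len_complete CL) => e e0.
have [N hN] := decreasing_ge0_cauchy _ phi0 dphi _ e0.
exists N => i j Ni Nj.
have [ij|/ltnW ji] := leqP i j.
  exact: (len_le CL (descending_chain _ _ _ _ hu ij) (ltW (hN _ _ Ni Nj))).
apply: (len_sym CL).
exact: (len_le CL (descending_chain _ _ _ _ hu ji) (ltW (hN _ _ Nj Ni))).
Qed.

Section Covering.
Context {m : nat} {f : T -> 'rV[R]_m} {W : set 'rV[R]_m} {p0 : T} {r0 : R}.
Hypothesis f_lip : forall x y l, C x y l -> enorm (f x - f y) <= l.
Hypothesis fW : forall x, W (f x).
Hypothesis slope : forall q a b, C p0 q a -> a < r0 -> W b -> f q != b ->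
  exists y l, [/\ 0 < l, C q y l &
    enorm (f y - b) <= enorm (f q - b) - 9 / 10 * l].

(* Ekeland's variational principle for the distance to [b]. *)
Lemma metric_regularity q a b : C p0 q a -> W b ->
  a + 9 / 8 * enorm (f q - b) < r0 ->
  exists2 y, f y = b & C q y (9 / 8 * enorm (f q - b)).
Proof.
move=> p0q Wb qr; have [qb|qb] := eqVneq (f q) b.
  by exists q => //; rewrite qb subrr enorm0 mulr0; exact: (len_refl CL).
pose phi x := enorm (f x - b).
have phi0 x : 0 <= phi x by exact: enorm_ge0.
have phiC x y l : C x y l -> phi x <= phi y + l.
  move=> /f_lip xy; rewrite /phi (le_trans (enorm_triangle (f y) _ _))//.
  by rewrite addrC lerD2l.
pose lam : R := 179 / 200.
have lam0 : 0 < lam by rewrite /lam; lra.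
pose S x y := exists2 l, C x y l & phi y + lam * l <= phi x.
have Sx x : S x x.
  by exists 0; [exact: (len_refl CL)|rewrite mulr0 addr0].
have /choice[g hg] : forall x, exists y, S x y /\
    forall z, S x z -> phi y <= (phi x + phi z) / 2.
  move=> x; have infS : has_inf (phi @` S x).
    split; first by exists (phi x); exists x => //.
    by exists 0 => _ [y _ <-].
  have lbS z : S x z -> inf (phi @` S x) <= phi z.
    by move=> xz; apply: ge_inf; [case: infS|exists z].
  have [xinf|infx] := leP (phi x) (inf (phi @` S x)).
    by exists x; split=> // z /lbS; lra.
  have e0 : 0 < (phi x - inf (phi @` S x)) / 2 by lra.
  have [_ [y xy <-] hy] := inf_adherent e0 infS.
  by exists y; split=> // z /lbS; lra.
pose u k := iter k g q.
have stepu k : C (u k) (u k.+1) (phi (u k) / lam - phi (u k.+1) / lam).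
  have [[l hC hl] _] := hg (u k); apply: (len_le CL hC).
  rewrite -mulrBl ler_pdivlMr// lerBrDl mulrC; exact: hl.
have psi0 k : 0 <= phi (u k) / lam by rewrite divr_ge0// ltW.
have [p hp] := descending_limit u (fun k => phi (u k) / lam) psi0 stepu.
have uC i j : (i <= j)%N -> C (u i) (u j) (phi (u i) / lam - phi (u j) / lam).
  exact: (descending_chain u (fun k => phi (u k) / lam) i j stepu).
have phiq : 0 < phi q by rewrite enorm_gt0// subr_eq0.
have qp : C q p (9 / 8 * phi q).
  have e0 : 0 < phi q / 1000 by lra.
  have [N hN] := hp _ e0.
  apply: (len_le CL (len_trans CL (uC 0%N N (leq0n N)) (hN N (leqnn N)))).
  have := psi0 N; rewrite /lam /=; lra.
exists p => //; apply/eqP; apply: contraT => pb.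
have [y [l [l0 py ly]]] := slope _ _ _ (len_trans CL p0q qp) qr Wb pb.
have uy k : phi (u k.+1) <= (phi (u k) + phi y) / 2.
  apply: (hg (u k)).2.
  have e0 : 0 < l / 400 by lra.
  have [N hN] := hp _ e0.
  pose n := maxn N k.
  have up := hN n (leq_maxl _ _).
  exists (phi (u k) / lam - phi (u n) / lam + l / 400 + l).
    by apply: (len_trans CL (len_trans CL (uC k n (leq_maxr _ _)) up) py).
  have := phiC _ _ _ (len_sym CL up); rewrite -/(phi y) -/(phi p) in ly *.
  have -> : lam * (phi (u k) / lam - phi (u n) / lam + l / 400 + l) =
      phi (u k) - phi (u n) + lam * (l / 400 + l).
    by field; rewrite gt_eqF.
  by rewrite /lam; lra.
have e0 : 0 < l / 10 by lra.
have [N hN] := hp _ e0.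
have := phiC _ _ _ (len_sym CL (hN N.+1 (leqnSn N))).
have := phiC _ _ _ (hN N (leqnn N)).
have := uy N; rewrite -/(phi y) -/(phi p) in ly; lra.
Qed.

Hypothesis loc_inj : forall q a, C p0 q a -> a < r0 ->
  exists2 e, 0 < e & forall z y, C z q e -> C y q e -> f z = f y -> z = y.

(* Either the midpoint of the path can be pushed into the fibre, or the two
   halves of the path nearly project onto the same segment run there and back. *)
Lemma shorten_fibre_pair z y l a : C p0 z a -> C z y l -> a + 2 * l < r0 ->
  f z = f y -> z <> y ->
  exists z' y', [/\ C z z' (l / 4), C z' y' (19 / 20 * l), f z' = f y' & z' <> y'].
Proof.
move=> p0z zy ar fzy zy_neq.
have l0 := len_ge0 CL zy.
have [w zw wy] : exists2 w, C z w (l / 2) & C w y (l - l / 2).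
  by apply: (len_split CL _ zy); lra.
have [cs|cb] := leP (enorm (f w - f z)) (2 / 5 * l).
  have [|w' fw' ww'] := metric_regularity w _ (f z) (len_trans CL p0z zw) (fW z).
    lra.
  have [zw'|zw'] := pselect (z = w').
    exists z, y; split=> //.
      by apply: (len_le CL (len_refl CL z)); lra.
    rewrite -zw' in ww'.
    by apply: (len_le CL (len_trans CL (len_sym CL ww') wy)); lra.
  exists z, w'; split=> //.
    by apply: (len_le CL (len_refl CL z)); lra.
  by apply: (len_le CL (len_trans CL zw ww')); lra.
have [u zu uw] : exists2 u, C z u (l / 4) & C u w (l / 2 - l / 4).
  by apply: (len_split CL _ zw); lra.
have [v wv vy] : exists2 v, C w v (l / 4) & C v y (l - l / 2 - l / 4).
  by apply: (len_split CL _ wy); lra.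
have half x : enorm (f x - f z) <= l / 4 -> enorm (f x - f w) <= l / 4 ->
    enorm (f x - f z - (1 / 2) *: (f w - f z)) <= 3 / 20 * l.
  have -> : f x - f w = (f x - f z) - (f w - f z) by rewrite opprB addrA subrK.
  move: (f x - f z) (f w - f z) cb => A B cb Al ABl.
  rewrite -(@ler_pXn2r _ 2)// ?nnegrE ?enorm_ge0//; last by lra.
  have hA : dot A A <= (l / 4) ^+ 2.
    by rewrite -sqr_enorm ler_pXn2r// ?nnegrE ?enorm_ge0//; lra.
  have hAB : dot (A - B) (A - B) <= (l / 4) ^+ 2.
    by rewrite -sqr_enorm ler_pXn2r// ?nnegrE ?enorm_ge0//; lra.
  have hB : (2 / 5 * l) ^+ 2 <= dot B B.
    by rewrite -sqr_enorm ler_pXn2r// ?nnegrE ?enorm_ge0//; lra.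
  move: hA hAB hB; rewrite sqr_enorm !dotBl !dotBr !dotZl !dotZr (dotC B A).
  by lra.
have uv : enorm (f v - f u) <= 3 / 10 * l.
  have -> : f v - f u = (f v - f z - (1 / 2) *: (f w - f z)) -
                        (f u - f z - (1 / 2) *: (f w - f z)).
    by apply/rowP => i; rewrite !mxE; ring.
  rewrite (le_trans (enormD _ _))// enormN.
  have -> : 3 / 10 * l = 3 / 20 * l + 3 / 20 * l by lra.
  rewrite lerD// half//.
  - by rewrite fzy; apply: (le_trans (f_lip _ _ _ vy)); lra.
  - by rewrite enormBC; apply: f_lip.
  - by rewrite enormBC; apply: f_lip.
  - by apply: (le_trans (f_lip _ _ _ uw)); lra.
have p0v := len_trans CL (len_trans CL p0z zw) wv.
have [|v' fv' vv'] := metric_regularity v _ (f u) p0v (fW u).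
  lra.
have [uv'|uv'] := pselect (u = v').
  exists z, y; split=> //.
    by apply: (len_le CL (len_refl CL z)); lra.
  rewrite -uv' in vv'.
  by apply: (len_le CL (len_trans CL zu (len_trans CL (len_sym CL vv') vy))); lra.
exists u, v'; split=> //.
apply: (len_le CL (len_trans CL (len_trans CL uw wv) vv')); lra.
Qed.

Lemma injective_in_ball z y l a : C p0 z a -> C z y l -> a + 5 * l < r0 ->
  f z = f y -> z = y.
Proof.
move=> p0z zy ar fzy; apply: contrapT => zy_neq.
have l0 := len_ge0 CL zy.
pose P (s : T * T * R * R) := [/\ C p0 s.1.1.1 s.2, C s.1.1.1 s.1.1.2 s.1.2,
  s.2 + 5 * s.1.2 <= a + 5 * l, f s.1.1.1 = f s.1.1.2 & s.1.1.1 <> s.1.1.2].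
have /choice[g hg] : forall s, exists s', P s -> [/\ P s',
    C s.1.1.1 s'.1.1.1 (s.1.2 / 4) & s'.1.2 = 19 / 20 * s.1.2].
  move=> s; have [Ps|] := pselect (P s); last by exists s.
  have [p0x xy ab fxy xy_neq] := Ps.
  have b0 := len_ge0 CL xy.
  have [|x' [y' [xx' xy' fxy' xy'_neq]]] :=
    shorten_fibre_pair _ _ _ _ p0x xy _ fxy xy_neq; first by lra.
  exists (x', y', 19 / 20 * s.1.2, s.2 + s.1.2 / 4) => _; split=> //.
  by split=> //=; [exact: (len_trans CL p0x xx')|lra].
pose s k := iter k g (z, y, l, a).
have Ps k : P (s k).
  elim: k => [|k ih]; first by split=> //=; lra.
  by have [] := hg _ ih.
have step k : C (s k).1.1.1 (s k.+1).1.1.1 (5 * (s k).1.2 - 5 * (s k.+1).1.2).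
  have [_ hC ->] := hg _ (Ps k).
  have [_ /(len_ge0 CL) b0 _ _ _] := Ps k.
  by apply: (len_le CL hC); lra.
have ell0 k : 0 <= 5 * (s k).1.2.
  by have [_ /(len_ge0 CL) b0 _ _ _] := Ps k; lra.
have [p hp] := descending_limit _ _ ell0 step.
have ellS k : 5 * (s k.+1).1.2 <= 5 * (s k).1.2.
  by have := len_ge0 CL (step k); rewrite subr_ge0.
have [N0 hN0] := hp _ (ltac:(rewrite subr_gt0; exact: ar) : 0 < r0 - (a + 5 * l)).
have [e0 e00 he0] : exists2 e, 0 < e &
    forall z y, C z p e -> C y p e -> f z = f y -> z = y.
  have [N1 hN1] := hp _ (ltac:(rewrite divr_gt0// subr_gt0; exact: ar)
    : 0 < (r0 - (a + 5 * l)) / 2).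
  have [p0x xy ab _ _] := Ps N1.
  apply: (loc_inj _ _ (len_trans CL p0x (hN1 N1 (leqnn _)))).
  by have := len_ge0 CL xy; lra.
have e2 : 0 < e0 / 2 by lra.
have [N1 hN1] := hp _ e2.
have e8 : 0 < e0 / 8 by lra.
have [N2 hN2] := decreasing_ge0_cauchy _ ell0 ellS _ e8.
pose k := maxn N1 N2.
have [_ xy _ fxy xy_neq] := Ps k.
have xp := hN1 k (leq_maxl _ _).
have := hN2 k k.+1 (leq_maxr _ _) (leqW (leq_maxr _ _)).
have [_ _ ->] := hg _ (Ps k); move=> small.
apply: xy_neq; apply: he0 => //.
  by apply: (len_le CL xp); lra.
apply: (len_le CL (len_trans CL (len_sym CL xy) xp)); lra.
Qed.

Lemma compact_maximum (d : nat) (G : T -> 'rV[R]_d) (Phi : 'rV[R]_d -> R) :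
  (forall x y l, C x y l -> enorm (G x - G y) <= l) -> continuous Phi ->
  closed W -> 0 < r0 ->
  exists q, [/\ C p0 q (r0 / 50), enorm (f q - f p0) <= r0 / 64 &
    forall y, C p0 y (r0 / 16) -> enorm (f y - f p0) <= r0 / 64 ->
      Phi (G y) <= Phi (G q)].
Proof.
move=> G_lip Phi_cont W_closed r00.
have uniq_fibre z y : C p0 z (r0 / 16) -> C p0 y (r0 / 16) -> f z = f y -> z = y.
  move=> p0z p0y.
  apply: (injective_in_ball _ _ _ _ p0z (len_trans CL (len_sym CL p0z) p0y)).
  lra.
pose K : set 'rV[R]_m := [set b | W b /\ enorm (b - f p0) <= r0 / 64].
have /choice[s hs] : forall b, exists y, K b -> f y = b /\ C p0 y (r0 / 50).
  move=> b; have [[Wb bp]|] := pselect (K b); last by exists p0.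
  rewrite enormBC in bp.
  have [|y fy p0y] := metric_regularity p0 _ b (len_refl CL p0) Wb; first by lra.
  by exists y => _; split=> //; apply: (len_le CL p0y); lra.
have s_lip b b' : K b -> K b' -> C (s b) (s b') (9 / 8 * enorm (b - b')).
  move=> Kb Kb'; have [fb p0b] := hs _ Kb; have [fb' p0b'] := hs _ Kb'.
  have bb' : enorm (b - b') <= r0 / 32.
    rewrite (le_trans (enorm_triangle (f p0) _ _))// (enormBC (f p0)).
    by have := Kb.2; have := Kb'.2; lra.
  have [|y fy sby] := metric_regularity (s b) _ b' p0b Kb'.1.
    by rewrite fb; lra.
  rewrite fb in sby.
  have -> : s b' = y => //.
  apply: uniq_fibre; rewrite ?fb' ?fy//.
    by apply: (len_le CL p0b'); lra.
  by apply: (len_le CL (len_trans CL p0b sby)); lra.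
have Kp0 : K (f p0) by split; [exact: fW|rewrite subrr enorm0; lra].
have closed_ball_b : closed [set b : 'rV[R]_m | enorm (b - f p0) <= r0 / 64].
  have /continuous_closedP := enormB_continuous (f p0).
  by move=> /(_ _ (@closed_le _ (r0 / 64))).
have Kcompact : compact K.
  apply: bounded_closed_compact; last exact: closedI.
  exists (`|f p0| + r0); split; first exact: num_real.
  move=> x xM b [_ bp]; apply: le_trans (ltW xM); rewrite -lerBlDl.
  rewrite (le_trans (lerB_dist _ _))// (le_trans (normr_le_enorm _))//.
  by rewrite (le_trans bp)//; lra.
have cont : {within K, continuous (fun b => Phi (G (s b)))}.
  apply/subspace_continuousP => b Kb.
  apply: (@cvg_comp _ _ _ (fun b => G (s b)) Phi); last exact: Phi_cont.
  apply/cvgrPdist_le => e e0.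
  rewrite ?near_simpl /=.
  have : \forall b' \near b, enorm (b - b') <= e / 2.
    have e2 : 0 < e / 2 by lra.
    have /(@cvgrPdist_le _ _ _ (nbhs b) (nbhs_filter b))/(_ _ e2) :=
      enormB_continuous b b.
    apply: filterS => b'; rewrite subrr enorm0 sub0r normrN enormBC.
    by rewrite ger0_norm// enorm_ge0.
  rewrite near_withinE; apply: filterS => b' bb' Kb'.
  rewrite (le_trans (normr_le_enorm _))//.
  rewrite (le_trans (G_lip _ _ _ (s_lip _ _ Kb Kb')))//; lra.
have [b /set_mem Kb bmax] := EVT_max_rV (ex_intro K _ Kp0) Kcompact cont.
have [fb p0b] := hs _ Kb.
exists (s b); split=> //; first by rewrite fb; exact: Kb.2.
move=> y p0y yp.
have Ky : K (f y) by split.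
have [fsy p0sy] := hs _ Ky.
have -> : y = s (f y).
  apply: uniq_fibre => //; apply: (len_le CL p0sy); lra.
by apply: bmax; exact/mem_set.
Qed.

End Covering.
End LengthStructure.

(** * Calculus in charts *)

Section MatrixDerivative.
Context {R : realType}.

Lemma derivable_coordP {p q : nat} (M : R -> 'M[R]_(p, q)) (t : R) :
  derivable M t 1 <-> forall i j, derivable (fun s => M s i j) t 1.
Proof. exact: (@derivable_mxP R R p q M t 1). Qed.

Lemma is_derive_mxP {p q : nat} (M : R -> 'M[R]_(p, q)) (t : R) (dM : 'M[R]_(p, q)) :
  is_derive t 1 M dM <-> forall i j, is_derive t 1 (fun s => M s i j) (dM i j).
Proof.
split=> [[Mt <-] i j|Mt].
  apply: DeriveDef; first exact: (derivable_coordP _ _).1.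
  by rewrite (@derive_mx R R)// mxE.
have dMt : derivable M t 1 by apply/derivable_coordP => i j; have [] := Mt i j.
apply: DeriveDef => //.
by apply/matrixP => i j; rewrite (@derive_mx R R)// mxE; have [] := Mt i j.
Qed.

Lemma is_derive_sumr {I : finType} (h : I -> R -> R) (dh : I -> R) (t : R) :
  (forall i, is_derive t 1 (h i) (dh i)) ->
  is_derive t 1 (fun s => \sum_i h i s) (\sum_i dh i).
Proof.
move=> dht.
have -> : (fun s => \sum_i h i s) =
    \sum_(k < #|I|) h (enum_val k).
  apply/funext => s; rewrite fct_sumE (reindex (@enum_val I xpredT))//=.
  exact/onW_bij/enum_val_bij.
rewrite (reindex (@enum_val I xpredT))/=; last exact/onW_bij/enum_val_bij.
exact: is_derive_sum.
Qed.

Lemma is_derive_mulr (f g : R -> R) (t df dg : R) :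
  is_derive t 1 f df -> is_derive t 1 g dg ->
  is_derive t 1 (fun s => f s * g s) (df * g t + f t * dg).
Proof.
move=> ft gt; have := is_deriveM ft gt.
by rewrite [g t *: df]mulrC [X in is_derive _ _ _ X]addrC.
Qed.

Lemma is_derive_subr (f g : R -> R) (t df dg : R) :
  is_derive t 1 f df -> is_derive t 1 g dg ->
  is_derive t 1 (fun s => f s - g s) (df - dg).
Proof. exact: is_deriveB. Qed.

Lemma is_derive_mulmx {p q r : nat} (M : R -> 'M[R]_(p, q)) (N : R -> 'M[R]_(q, r))
    (t : R) dM dN : is_derive t 1 M dM -> is_derive t 1 N dN ->
  is_derive t 1 (fun s => M s *m N s) (dM *m N t + M t *m dN).
Proof.
move=> /is_derive_mxP Mt /is_derive_mxP Nt; apply/is_derive_mxP => i k.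
have -> : (fun s => (M s *m N s) i k) = (fun s => \sum_j M s i j * N s j k).
  by apply/funext => s; rewrite mxE.
rewrite !mxE -big_split/=; apply: is_derive_sumr => j.
exact: is_derive_mulr.
Qed.

Lemma is_derive_trmx {p q : nat} (M : R -> 'M[R]_(p, q)) (t : R) dM :
  is_derive t 1 M dM -> is_derive t 1 (fun s => (M s)^T) dM^T.
Proof.
move=> /is_derive_mxP Mt; apply/is_derive_mxP => i j.
have -> : (fun s => (M s)^T i j) = (fun s => M s j i).
  by apply/funext => s; rewrite mxE.
by rewrite mxE; exact: Mt.
Qed.

Lemma is_derive_dot {q : nat} (u v : R -> 'rV[R]_q) (t : R) du dv :
  is_derive t 1 u du -> is_derive t 1 v dv ->
  is_derive t 1 (fun s => dot (u s) (v s)) (dot du (v t) + dot (u t) dv).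
Proof.
move=> ut vt; have /is_derive_mxP/(_ 0 0) := is_derive_mulmx _ _ _ _ _ ut
  (is_derive_trmx _ _ _ vt).
by rewrite mxE.
Qed.

Lemma derivable_det {p : nat} (M : R -> 'M[R]_p) (t : R) :
  derivable M t 1 -> derivable (fun s => \det (M s)) t 1.
Proof.
elim: p M => [|p ih] M Mt.
  by under eq_fun do rewrite det_mx00; exact: derivable_cst.
under eq_fun do rewrite (expand_det_row _ ord0).
have /derivable_coordP Mij := Mt.
suff h j : derivable (fun s => M s ord0 j * cofactor (M s) ord0 j) t 1.
  have := is_derive_sumr _ _ t (fun j => derivableP (h j)).
  by case.
apply: derivableM => //; rewrite /cofactor.
apply: derivableM => //; apply: ih.
apply/derivable_coordP => a b; under eq_fun do rewrite !mxE.
exact: Mij.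
Qed.

(* The inverse in a form that is visibly differentiable; [invmx] itself is
   defined by cases. *)
Lemma derivable_det_adj {p : nat} (M : R -> 'M[R]_p) (t : R) :
  \det (M t) != 0 -> derivable M t 1 ->
  derivable (fun s => (\det (M s))^-1 *: \adj (M s)) t 1.
Proof.
move=> dM Mt; have /derivable_coordP Mij := Mt.
apply/derivable_coordP => i j; under eq_fun do rewrite !mxE.
apply: derivableM; first exact: derivableV (derivable_det _ _ Mt).
rewrite /cofactor; apply: derivableM => //.
apply: derivable_det.
apply/derivable_coordP => a b; under eq_fun do rewrite !mxE.
exact: Mij.
Qed.

Lemma is_derive_line {p : nat} (x v : 'rV[R]_p) (t : R) :
  is_derive t 1 (fun s : R => x + s *: v) v.
Proof.
apply/is_derive_mxP => i j; under eq_fun do rewrite !mxE.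
have := is_deriveD (is_derive_cst (x i j) t 1)
  (is_derive_mulr _ _ _ _ _ (is_derive_id t 1) (is_derive_cst (v i j) t 1)).
by rewrite add0r mul1r mulr0 addr0.
Qed.

Lemma is_derive_comp_diff {p q : nat} (X : 'rV[R]_p -> 'rV[R]_q)
    (g : R -> 'rV[R]_p) (t : R) (dg : 'rV[R]_p) :
  is_derive t 1 g dg -> differentiable X (g t) ->
  is_derive t 1 (X \o g) (dg *m 'J X (g t)).
Proof.
move=> [/derivable1_diffP dgt <-] dX.
have dXg : differentiable (X \o g) t by exact: differentiable_comp.
apply: DeriveDef; first exact/derivable1_diffP.
by rewrite deriveE// diff_comp//= -deriveE// -deriveE// deriveEjacobian.
Qed.

Lemma is_derive_comp_line {p q : nat} (X : 'rV[R]_p -> 'rV[R]_q) (x v : 'rV[R]_p)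
    (t : R) : differentiable X (x + t *: v) ->
  is_derive t 1 (fun s : R => X (x + s *: v)) (v *m 'J X (x + t *: v)).
Proof. exact: (is_derive_comp_diff X _ _ _ (is_derive_line x v t)). Qed.

Lemma derivable_continuous (f : R -> R) (t : R) :
  derivable f t 1 -> {for t, continuous f}.
Proof. by move=> /derivable1_diffP/differentiable_continuous. Qed.

Lemma MVT_le (f df : R -> R) (l : R) :
  (forall t : R, 0 <= t <= 1 -> is_derive t 1 f (df t)) ->
  (forall t : R, 0 <= t <= 1 -> df t <= l) -> f 1 - f 0 <= l.
Proof.
move=> fd dfl.
have [||c] := @MVT_segment _ f df 0 1 ler01.
- by move=> x; rewrite in_itv/= => /andP[x0 x1]; apply: fd; rewrite !ltW.
- apply: derivable_within_continuous => x; rewrite in_itv/= => xI.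
  by have [] := fd x xI.
- by rewrite in_itv/= subr0 mulr1 => cI ->; exact: dfl.
Qed.

Lemma enorm_MVT {q : nat} (g dg : R -> 'rV[R]_q) (l : R) :
  (forall t : R, 0 <= t <= 1 -> is_derive t 1 g (dg t)) ->
  (forall t : R, 0 <= t <= 1 -> enorm (dg t) <= l) -> enorm (g 1 - g 0) <= l.
Proof.
move=> gd gl; apply: enorm_le_dot => [w w1|]; last first.
  by apply: (le_trans _ (gl 0 _)); rewrite ?enorm_ge0// lexx ler01.
rewrite dotBl; apply: (MVT_le (fun t => dot (g t) w) (fun t => dot (dg t) w)).
  move=> t tI; apply: is_derive_eq (is_derive_dot _ _ _ _ _ (gd t tI)
    (is_derive_cst w t 1)) _.
  by rewrite [X in _ + X]dotC dot0l addr0.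
move=> t tI; apply: (le_trans (dot_le_enorm _ _)).
by rewrite w1 mulr1 gl.
Qed.

End MatrixDerivative.

(* Locked, because unification otherwise unfolds the limits in the derivatives. *)
HB.lock Definition jac (R : realType) (n k : nat) (X : 'rV[R]_n -> 'rV[R]_k)
  (x : 'rV[R]_n) : 'M[R]_(n, k) := \matrix_i partial i X x.
Arguments jac {R n k}.

Lemma row_jac {R : realType} {n k : nat} (X : 'rV[R]_n -> 'rV[R]_k) x i :
  row i (jac X x) = partial i X x.
Proof. by rewrite jac.unlock rowK. Qed.

Lemma jacobianE {R : realType} {n k : nat} (X : 'rV[R]_n -> 'rV[R]_k) x :
  differentiable X x -> 'J X x = jac X x.
Proof.
move=> dX; apply/row_matrixP => i.
by rewrite row_jac /partial deriveEjacobian// rowE.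
Qed.

Lemma mulmx_jac {R : realType} {n k : nat} (X : 'rV[R]_n -> 'rV[R]_k) x v :
  v *m jac X x = \sum_i v 0 i *: partial i X x.
Proof. by rewrite mulmx_sum_row; apply: eq_bigr => i _; rewrite row_jac. Qed.

Lemma rowB {R : realType} {n k : nat} i (A B : 'M[R]_(n, k)) :
  row i (A - B) = row i A - row i B.
Proof. exact: raddfB. Qed.

Lemma enorm_mulmx_rows {R : realType} {n k : nat} (A : 'M[R]_(n, k)) (d : R) v :
  (forall i, `|row i A| <= d) -> enorm (v *m A) <= n%:R * k%:R * d * `|v|.
Proof.
move=> Ad; rewrite mulmx_sum_row.
apply: (@le_trans _ _ (\sum_(i < n) k%:R * d * `|v|)); last first.
  by rewrite sumr_const card_ord -[leLHS]mulr_natl !mulrA.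
elim/big_ind2 : _ => [|a a' b b' ha hb|i _].
- by rewrite enorm0.
- by rewrite (le_trans (enormD _ _))// lerD.
rewrite enormZ mulrC ler_pM ?enorm_ge0 ?normr_coord_le//.
by rewrite (le_trans (enorm_le_normr _))// ler_wpM2l.
Qed.

Lemma open_ball_inside {R : realType} {n : nat} (U : set 'rV[R]_n) (x0 : 'rV[R]_n) :
  open U -> U x0 -> exists2 rho, 0 < rho & forall x, `|x - x0| < rho -> U x.
Proof.
move=> oU Ux0; have /nbhs_ballP[rho /= rho0 hrho] := open_nbhs_nbhs (conj oU Ux0).
exists rho => // x xx0; apply: hrho; rewrite -ball_normE /= distrC; exact: xx0.
Qed.

Lemma normr_segment_lt {R : realType} {n : nat} (x0 x y : 'rV[R]_n) (rho t : R) :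
  0 <= t <= 1 -> `|x - x0| < rho -> `|y - x0| < rho ->
  `|x + t *: (y - x) - x0| < rho.
Proof.
move=> /andP[t0 t1] xr yr.
have -> : x + t *: (y - x) - x0 = (1 - t) *: (x - x0) + t *: (y - x0).
  by apply/rowP => i; rewrite !mxE; ring.
rewrite (le_lt_trans (ler_normD _ _))// !normrZ (ger0_norm t0) ger0_norm ?subr_ge0//.
have [t00|t00] := eqVneq t 0; first by rewrite t00; lra.
have tp : 0 < t by rewrite lt_def t00.
have : 0 <= 1 - t by lra.
by nra.
Qed.

Section Chart.
Context {R : realType} {n k : nat} {X : 'rV[R]_n -> 'rV[R]_k} {U : set 'rV[R]_n}.
Hypothesis oU : open U.
Hypothesis dX : forall x, U x -> differentiable X x.
Hypothesis cX : forall i x, U x -> {for x, continuous (partial i X)}.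

Lemma jacobian_near (x0 : 'rV[R]_n) (eta : R) : U x0 -> 0 < eta ->
  exists2 rho, 0 < rho & forall x, `|x - x0| < rho ->
    U x /\ forall v, enorm (v *m jac X x - v *m jac X x0) <= eta * `|v|.
Proof.
move=> Ux0 eta0.
have d0 : 0 < eta / (n * k).+1%:R by rewrite divr_gt0// ltr0n.
have near_partial i : \forall x \near x0,
    `|partial i X x0 - partial i X x| <= eta / (n * k).+1%:R.
  have /(@cvgrPdist_le _ _ _ (nbhs x0) (nbhs_filter x0))/(_ _ d0) := cX i _ Ux0.
  exact.
have : \forall x \near x0, U x /\ forall i,
    `|partial i X x0 - partial i X x| <= eta / (n * k).+1%:R.
  apply: filterI; first exact: open_nbhs_nbhs.
  exact: filter_forall near_partial.
move=> /nbhs_ballP[rho /= rho0 hrho]; exists rho => // x xx0.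
have [|Ux hx] := hrho x; first by rewrite -ball_normE /= distrC.
split; first exact: Ux.
move=> v; rewrite -mulmxBr.
apply: (@le_trans _ _ (n%:R * k%:R * (eta / (n * k).+1%:R) * `|v|)).
  apply: enorm_mulmx_rows => i.
  rewrite rowB !row_jac.
  by rewrite distrC; exact: hx.
rewrite ler_wpM2r// mulrCA -natrM ler_piMr ?(ltW eta0)//.
by rewrite ler_pdivrMr ?ltr0n// mul1r ler_nat.
Qed.

Lemma strict_differentiability (x0 : 'rV[R]_n) (eta : R) : U x0 -> 0 < eta ->
  exists2 rho, 0 < rho & [/\ forall x, `|x - x0| < rho -> U x,
    forall x v, `|x - x0| < rho ->
      enorm (v *m jac X x - v *m jac X x0) <= eta * `|v| &
    forall x y, `|x - x0| < rho -> `|y - x0| < rho ->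
      enorm (X y - X x - (y - x) *m jac X x0) <= eta * `|y - x|].
Proof.
move=> Ux0 eta0; have [rho rho0 hrho] := jacobian_near _ _ Ux0 eta0.
exists rho => //; split=> [x /hrho[]//|x v /hrho[_]//|x y xr yr].
pose g (t : R) := X (x + t *: (y - x)) - t *: ((y - x) *m jac X x0).
have -> : X y - X x - (y - x) *m jac X x0 = g 1 - g 0.
  by rewrite /g !scale1r !scale0r addr0 subr0 (addrC x) subrK addrAC.
apply: (enorm_MVT g (fun t => (y - x) *m jac X (x + t *: (y - x)) -
  (y - x) *m jac X x0)) => t tI; have seg := normr_segment_lt _ _ _ _ _ tI xr yr.
  have line := is_derive_line 0 ((y - x) *m jac X x0) t.
  have {line} : is_derive t 1 (fun s : R => s *: ((y - x) *m jac X x0))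
      ((y - x) *m jac X x0).
    by under eq_fun do rewrite -[_ *: _]add0r.
  move=> line; apply: (is_deriveB _ line).
  by rewrite -jacobianE; [apply: is_derive_comp_line|]; apply/dX/(hrho _ seg).1.
exact: (hrho _ seg).2.
Qed.

Lemma jacobian_bounded_near (x0 : 'rV[R]_n) : U x0 ->
  exists rho B : R, [/\ 0 < rho, 0 < B,
    forall x, `|x - x0| < rho -> U x &
    forall x v, `|x - x0| < rho -> enorm (v *m jac X x) <= B * `|v|].
Proof.
move=> Ux0; have [rho rho0 [rU rJ _]] := strict_differentiability _ _ Ux0 ltr01.
have [B B0 hB] := enorm_mulmx_le (jac X x0).
exists rho, (1 + B); split=> //; first by rewrite addr_gt0.
move=> x v xr; rewrite mulrDl.
have := rJ _ v xr; have := hB v; have := enormB (v *m jac X x) (v *m jac X x0); lra.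
Qed.

Lemma local_expansion (p : nat) (P : 'M[R]_(k, p)) (x0 : 'rV[R]_n) (c : R) :
  U x0 -> 0 < c -> (forall v, c * `|v| <= enorm (v *m jac X x0 *m P)) ->
  exists2 rho, 0 < rho & (forall x, `|x - x0| < rho -> U x) /\
    forall x y, `|x - x0| < rho -> `|y - x0| < rho ->
      c / 2 * `|y - x| <= enorm ((X y - X x) *m P).
Proof.
move=> Ux0 c0 hc; have [B B0 hB] := enorm_mulmx_le P.
have eta0 : 0 < c / (2 * B) by rewrite divr_gt0// mulr_gt0.
have [rho rho0 [rU _ rX]] := strict_differentiability _ _ Ux0 eta0.
exists rho => //; split=> // x y xr yr.
have h1 := hc (y - x); have h2 := rX _ _ xr yr.
have h3 : enorm ((X y - X x - (y - x) *m jac X x0) *m P) <= c / 2 * `|y - x|.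
  apply: (le_trans (hB _)).
  apply: (@le_trans _ _ (B * (c / (2 * B) * `|y - x|))).
    by rewrite ler_pM2l// (le_trans (normr_le_enorm _)).
  by rewrite mulrA; apply: ler_wpM2r => //; rewrite le_eqVlt; apply/orP; left;
    apply/eqP; field; rewrite gt_eqF.
rewrite mulmxBl in h3.
have := enormB ((y - x) *m jac X x0 *m P) ((X y - X x) *m P).
rewrite enormBC; lra.
Qed.

End Chart.

Lemma row_free_lower_bound {R : realType} {n k : nat} (A : 'M[R]_(n, k)) :
  row_free A -> exists2 c, 0 < c & forall v : 'rV[R]_n, c * `|v| <= enorm (v *m A).
Proof.
move=> /row_freeP[K AK]; have [B B0 hB] := enorm_mulmx_le K.
exists B^-1; first by rewrite invr_gt0.
move=> v; rewrite mulrC ler_pdivrMr// mulrC.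
have {1}-> : v = v *m A *m K by rewrite -mulmxA AK mulmx1.
rewrite (le_trans (normr_le_enorm _))// (le_trans (hB _))//.
by rewrite ler_pM2l// normr_le_enorm.
Qed.

(** * Second fundamental form *)

Section TangentProjection.
Context {R : realType} {n k : nat}.
Implicit Types (J : 'M[R]_(n, k)) (u v : 'rV[R]_k) (xi : 'rV[R]_n).

Definition tangent_coord J v : 'rV[R]_n := v *m J^T *m invmx (J *m J^T).
Definition tangent_part J v : 'rV[R]_k := tangent_coord J v *m J.

Lemma gram_unit J : row_free J -> J *m J^T \in unitmx.
Proof.
move=> Jfree; rewrite -row_free_unit; apply: inj_row_free => v vg0.
have vJ0 : v *m J = 0.
  by apply: dot_eq0; rewrite /dot trmx_mul mulmxA -(mulmxA v) vg0 mul0mx mxE.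
by apply: (row_free_inj Jfree); rewrite vJ0 mul0mx.
Qed.

Lemma gram_sym J : (J *m J^T)^T = J *m J^T.
Proof. by rewrite trmx_mul trmxK. Qed.

Lemma tangent_part_orth J v xi : row_free J -> dot (v - tangent_part J v) (xi *m J) = 0.
Proof.
move=> Jfree; rewrite dotC dot_mulmx mulmxBl /tangent_part /tangent_coord -!mulmxA.
by rewrite mulVmx ?gram_unit// mulmx1 subrr dotC dot0l.
Qed.

Lemma tangent_part_le J v xi : row_free J ->
  2 * dot v (xi *m J) - dot (xi *m J) (xi *m J) <=
  dot (tangent_part J v) (tangent_part J v).
Proof.
move=> Jfree; have := tangent_part_orth _ v xi Jfree; rewrite dotBl => /subr0_eq ->.
have := dot_ge0 (tangent_part J v - xi *m J).
rewrite dotBl !dotBr (dotC _ (tangent_part J v)); lra.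
Qed.

Lemma tangent_part_eq J v : row_free J ->
  2 * dot v (tangent_part J v) - dot (tangent_part J v) (tangent_part J v) =
  dot (tangent_part J v) (tangent_part J v).
Proof.
move=> Jfree; have := tangent_part_orth _ v (tangent_coord J v) Jfree.
rewrite dotBl => /subr0_eq; rewrite -/(tangent_part J v) => ->; lra.
Qed.

Lemma dot_tangent_part J v : row_free J ->
  dot v (tangent_part J v) = dot (tangent_part J v) (tangent_part J v).
Proof. by move=> Jfree; have := tangent_part_eq _ v Jfree; lra. Qed.

Lemma enorm_tangent_part J v : row_free J -> enorm (tangent_part J v) <= enorm v.
Proof.
move=> Jfree; have [->|T0] := eqVneq (tangent_part J v) 0.
  by rewrite enorm0 enorm_ge0.
rewrite -(ler_pM2r (enorm_gt0 _ T0)) -expr2 sqr_enorm -dot_tangent_part//.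
exact: dot_le_enorm.
Qed.

Lemma dot_tangent_partC J u v : dot (tangent_part J u) v = dot u (tangent_part J v).
Proof.
rewrite /tangent_part /tangent_coord dot_mulmx dot_mulmx trmx_inv.
by rewrite gram_sym dot_mulmx trmxK.
Qed.

Lemma dual_frame J : row_free J ->
  (invmx (J *m J^T) *m J) *m (invmx (J *m J^T) *m J)^T = invmx (J *m J^T).
Proof.
move=> Jfree; rewrite trmx_mul trmx_inv gram_sym mulmxA -(mulmxA _ J).
by rewrite mulVmx ?gram_unit// mul1mx.
Qed.

Lemma dual_frameK J xi : row_free J ->
  xi *m J *m (invmx (J *m J^T) *m J)^T = xi.
Proof.
move=> Jfree; rewrite trmx_mul trmx_inv gram_sym mulmxA -(mulmxA _ J).
by rewrite -mulmxA mulmxV ?gram_unit// mulmx1.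
Qed.

End TangentProjection.

Section BilinearBound.
Context {R : realType}.

Lemma sum_frame {n m k : nat} (B : 'M[R]_(n, m)) (A : 'I_n -> 'I_n -> 'rV[R]_k) :
  \sum_a \sum_b dot (\sum_i \sum_j (B i a * B j b) *: A i j)
                    (\sum_i \sum_j (B i a * B j b) *: A i j) =
  \sum_i \sum_j \sum_p \sum_q
    (B *m B^T) i p * (B *m B^T) j q * dot (A i j) (A p q).
Proof.
have dotE2 a b : dot (\sum_i \sum_j (B i a * B j b) *: A i j)
                    (\sum_i \sum_j (B i a * B j b) *: A i j) =
  \sum_i \sum_j \sum_p \sum_q
    B i a * B j b * (B p a * B q b) * dot (A i j) (A p q).
  rewrite dot_suml; apply: eq_bigr => i _.
  rewrite dot_suml; apply: eq_bigr => j _.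
  rewrite dotC dot_suml; apply: eq_bigr => p _.
  rewrite dot_suml; apply: eq_bigr => q _.
  by rewrite dotZl dotZr (dotC (A p q)); ring.
under eq_bigr do under eq_bigr do rewrite dotE2.
under eq_bigr do rewrite exchange_big/=.
rewrite exchange_big/=; apply: eq_bigr => i _.
under eq_bigr do rewrite exchange_big/=.
rewrite exchange_big/=; apply: eq_bigr => j _.
under eq_bigr do rewrite exchange_big/=.
rewrite exchange_big/=; apply: eq_bigr => p _.
under eq_bigr do rewrite exchange_big/=.
rewrite exchange_big/=; apply: eq_bigr => q _.
rewrite !mxE big_distrlr/= mulr_suml; apply: eq_bigr => a _.
by rewrite mulr_suml; apply: eq_bigr => b _; rewrite !mxE; ring.
Qed.

Lemma enorm_mulmx_frob {m k : nat} (V : 'rV[R]_m) (x : 'M[R]_(m, k)) :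
  enorm (V *m x) ^+ 2 <= enorm V ^+ 2 * \sum_a \sum_b x a b ^+ 2.
Proof.
rewrite sqr_enorm dotE exchange_big/= mulr_sumr; apply: ler_sum => b _.
have -> : (V *m x) 0 b = dot V (\row_a x a b).
  by rewrite mxE dotE; apply: eq_bigr => a _; rewrite mxE.
have -> : \sum_a x a b ^+ 2 = enorm (\row_a x a b) ^+ 2.
  by rewrite sqr_enorm dotE; apply: eq_bigr => a _; rewrite !mxE expr2.
rewrite -expr2 -exprMn -[leLHS]real_normK ?num_real//.
by rewrite ler_pXn2r ?nnegrE ?mulr_ge0 ?enorm_ge0// normr_dot_le.
Qed.

(* Cauchy-Schwarz for [A] expressed in the dual frame [B = g^-1 J]. *)
Lemma bilinear_form_bound {n k : nat} (J : 'M[R]_(n, k)) (A : 'I_n -> 'I_n -> 'rV[R]_k)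
    (nu : 'rV[R]_k) (K : R) (d xi : 'rV[R]_n) : row_free J -> enorm nu = 1 -> 0 <= K ->
  \sum_i \sum_j \sum_p \sum_q
    invmx (J *m J^T) i p * invmx (J *m J^T) j q * dot (A i j) (A p q) <= K ^+ 2 ->
  \sum_i \sum_j d 0 i * xi 0 j * dot nu (A i j) <=
    K * enorm (d *m J) * enorm (xi *m J).
Proof.
move=> Jfree nu1 K0 AK.
have [B BB BK] : exists2 B : 'M[R]_(n, k), B *m B^T = invmx (J *m J^T) &
    forall y : 'rV[R]_n, y *m J *m B^T = y.
  by exists (invmx (J *m J^T) *m J) => [|y]; [exact: dual_frame|exact: dual_frameK].
rewrite -BB -sum_frame in AK.
pose h : 'M[R]_n := \matrix_(i, j) dot nu (A i j).
pose x := B^T *m h *m B.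
have -> : \sum_i \sum_j d 0 i * xi 0 j * dot nu (A i j) =
    dot (d *m J *m x) (xi *m J).
  have BJxi : B *m (xi *m J)^T = xi^T.
    by rewrite -{2}(BK xi) [in RHS]trmx_mul trmxK.
  rewrite /dot /x !mulmxA BK -(mulmxA _ B) BJxi mxE.
  rewrite exchange_big/=; apply: eq_bigr => j _.
  rewrite [(d *m h) _ _]mxE [xi^T _ _]mxE mulr_suml; apply: eq_bigr => i _.
  by rewrite /h [(\matrix_(_, _) _) _ _]mxE mulrAC.
have xK : \sum_a \sum_b x a b ^+ 2 <= K ^+ 2.
  apply: le_trans AK; apply: ler_sum => a _; apply: ler_sum => b _.
  have -> : x a b = dot nu (\sum_i \sum_j (B i a * B j b) *: A i j).
    rewrite dotC dot_suml /x mxE.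
    under eq_bigr do rewrite [(B^T *m h) _ _]mxE mulr_suml.
    rewrite exchange_big/=; apply: eq_bigr => i _.
    rewrite dot_suml; apply: eq_bigr => j _.
    by rewrite /h [B^T _ _]mxE [(\matrix_(_, _) _) _ _]mxE dotZl (dotC nu); ring.
  rewrite -sqr_enorm -[leLHS]real_normK ?num_real//.
  rewrite ler_pXn2r ?nnegrE ?enorm_ge0//.
  by rewrite (le_trans (normr_dot_le _ _))// nu1 mul1r.
rewrite (le_trans (dot_le_enorm _ _))// ler_wpM2r ?enorm_ge0//.
rewrite -(@ler_pXn2r _ 2)// ?nnegrE ?mulr_ge0 ?enorm_ge0//.
rewrite (le_trans (enorm_mulmx_frob _ _))// exprMn mulrC.
by rewrite ler_wpM2r// exprn_ge0 ?enorm_ge0.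
Qed.

End BilinearBound.

Lemma is_derive_pos_right {R : realType} (f : R -> R) (c : R) :
  is_derive (0 : R) 1 f c -> f 0 = 0 -> 0 < c ->
  exists2 d, 0 < d & forall t, 0 < t < d -> 0 < f t.
Proof.
move=> [f0 fc] f00 c0.
have : (fun h : R => h^-1 *: (f (h *: (1 : R) + 0) - f 0)) @ 0^' --> c.
  by rewrite -fc; exact: f0.
move=> /cvgrPdist_lt/(_ _ c0); rewrite near_withinE => /nbhs_ballP[d /= d0 hd].
exists d => // t /andP[t0 td].
have /= := hd t _ _; rewrite f00 subr0 addr0 [t *: (1 : R)]mulr1 => ft.
have : `|c - t^-1 * f t| < c.
  by apply: ft; rewrite ?gt_eqF// -ball_normE /= sub0r normrN gtr0_norm.
move=> /ltr_normlW; rewrite ltrBlDr ltrDl => h.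
by rewrite -(pmulr_rgt0 _ (_ : 0 < t^-1)) ?invr_gt0.
Qed.

Lemma second_derivative_test {R : realType} (h h1 : R -> R) (c d : R) : 0 < d ->
  (forall t : R, `|t| < d -> is_derive t 1 h (h1 t)) -> is_derive (0 : R) 1 h1 c ->
  (forall t, `|t| < d -> h t <= h 0) -> h1 0 = 0 /\ c <= 0.
Proof.
move=> d0 hd h1c hmax.
have h10 : h1 0 = 0.
  have h0 : is_derive (0 : R) 1 h 0.
    apply: (@derive1_at_max _ h (- d) d 0) => [|t|| t].
    - by lra.
    - by rewrite in_itv/= -ltr_norml => /hd[].
    - by rewrite in_itv/= oppr_lt0 d0.
    - by rewrite in_itv/= -ltr_norml => /hmax.
  have [_ <-] := hd 0 (ltac:(by rewrite normr0)).
  by have [_] := h0.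
split=> //; rewrite leNgt; apply/negP => c0.
have [e e0 he] := is_derive_pos_right _ _ h1c h10 c0.
pose t : R := Num.min d e / 2.
have m0 : 0 < Num.min d e by rewrite lt_min d0.
have t0 : 0 < t by rewrite /t; lra.
have tm : t < Num.min d e by rewrite /t; lra.
have td : t < d by rewrite (lt_le_trans tm)// ge_min lexx.
have te : t < e by rewrite (lt_le_trans tm)// ge_min lexx orbT.
have [||s] := @MVT _ h h1 0 t t0.
- move=> s; rewrite in_itv/= => /andP[s0 st]; apply: hd.
  by rewrite gtr0_norm// (lt_trans st).
- apply: derivable_within_continuous => s; rewrite in_itv/= => /andP[s0 st].
  by have [] := hd s (ltac:(by rewrite ger0_norm// (le_lt_trans st))).
rewrite in_itv/= => /andP[s0 st]; rewrite subr0 => hts.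
have : 0 < h1 s * t by rewrite mulr_gt0// he// s0 (lt_trans st).
rewrite -hts subr_gt0 ltNge hmax// gtr0_norm//.
Qed.

Section ChartGeometry.
Context {R : realType} {n : nat} {X : 'rV[R]_n -> 'rV[R]_n.+1} {U : set 'rV[R]_n}.
Hypothesis dX : forall x, U x -> differentiable X x.
Hypothesis dP : forall i x, U x -> differentiable (partial i X) x.
Hypothesis freeX : forall x, U x -> row_free (jac X x).

Definition hess (x v w : 'rV[R]_n) : 'rV[R]_n.+1 :=
  \sum_i \sum_j (v 0 i * w 0 j) *: partial i (partial j X) x.

Lemma second_formE x i j : U x -> second_form X x i j =
  partial i (partial j X) x - tangent_part (jac X x) (partial i (partial j X) x).
Proof.
move=> Ux; rewrite /second_form /normal_part /first_form.
by rewrite (jacobianE _ _ (dX _ Ux)) /tangent_part /tangent_coord.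
Qed.

Lemma dot_normal x i j v : U x ->
  dot (v - tangent_part (jac X x) v) (partial i (partial j X) x) =
  dot v (second_form X x i j).
Proof. by move=> Ux; rewrite second_formE// dotBl dot_tangent_partC dotBr. Qed.

Lemma is_derive_jac (x v w : 'rV[R]_n) (t : R) : U (x + t *: v) ->
  is_derive t 1 (fun s : R => w *m jac X (x + s *: v)) (hess (x + t *: v) v w).
Proof.
move=> Ut; have -> : (fun s : R => w *m jac X (x + s *: v)) =
    (fun s : R => \sum_j w 0 j *: partial j X (x + s *: v)).
  by apply/funext => s; rewrite mulmx_jac.
have -> : hess (x + t *: v) v w =
    \sum_j w 0 j *: (v *m jac (partial j X) (x + t *: v)).
  rewrite /hess exchange_big/=; apply: eq_bigr => j _.
  rewrite mulmx_jac scaler_sumr; apply: eq_bigr => i _.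
  by rewrite scalerA mulrC.
apply/is_derive_mxP => a b; under eq_fun do rewrite summxE.
rewrite summxE; apply: is_derive_sumr => j.
have /is_derive_mxP/(_ a b) := is_derive_comp_line (partial j X) x v t (dP j _ Ut).
rewrite (jacobianE _ _ (dP j _ Ut)) => dj.
have := is_derive_mulr _ _ _ _ _ (is_derive_cst (w 0 j) t 1) dj.
rewrite mul0r add0r => wdj.
have -> : (w 0 j *: (v *m jac (partial j X) (x + t *: v))) a b =
    w 0 j * (v *m jac (partial j X) (x + t *: v)) a b by rewrite mxE.
have -> : (fun s => (w 0 j *: partial j X (x + s *: v)) a b) =
    (fun s => w 0 j * partial j X (x + s *: v) a b).
  by apply/funext => s; rewrite mxE.
exact: wdj.
Qed.

Lemma derivable_jac (x v : 'rV[R]_n) (t : R) : U (x + t *: v) ->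
  derivable (fun s : R => jac X (x + s *: v)) t 1.
Proof.
move=> Ut; apply/derivable_coordP => j b.
have /is_derive_mxP/(_ 0 b) := is_derive_jac x v (delta_mx 0 j) t Ut.
under eq_fun do rewrite -rowE mxE.
by case.
Qed.

(* [|A|^2 <= K^2] makes the squared length of the tangential part of the fixed
   unit vector [nu] Lipschitz with constant [2 K]: its derivative in a tangent
   direction [V] is [2 <A(V, nu^T), nu>]. *)
Lemma tilt_segment (nu : 'rV[R]_n.+1) (K l : R) (x v : 'rV[R]_n) :
  enorm nu = 1 -> 0 <= K ->
  (forall y, U y -> second_form_sqnorm X y <= K ^+ 2) ->
  (forall t : R, 0 <= t <= 1 -> U (x + t *: v) /\
    enorm (v *m jac X (x + t *: v)) <= l) ->
  dot (tangent_part (jac X (x + v)) nu) (tangent_part (jac X (x + v)) nu) <=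
  dot (tangent_part (jac X x) nu) (tangent_part (jac X x) nu) + 2 * K * l.
Proof.
move=> nu1 K0 AK seg.
pose J (t : R) := jac X (x + t *: v).
pose G (t : R) := J t *m (J t)^T.
pose xi (t : R) := nu *m (J t)^T *m ((\det (G t))^-1 *: \adj (G t)).
pose W (t : R) := xi t *m J t.
have Jfree t : 0 <= t <= 1 -> row_free (J t) by move=> /seg[Ut _]; exact: freeX.
have xiE t : 0 <= t <= 1 -> xi t = tangent_coord (J t) nu.
  by move=> tI; rewrite /xi /tangent_coord /invmx (gram_unit _ (Jfree t tI)).
have WE t : 0 <= t <= 1 -> W t = tangent_part (J t) nu.
  by move=> /xiE; rewrite /W /tangent_part => ->.
pose f (t : R) := 2 * dot nu (W t) - dot (W t) (W t).
have fE t : 0 <= t <= 1 -> f t = dot (tangent_part (J t) nu) (tangent_part (J t) nu).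
  by move=> tI; rewrite /f WE// tangent_part_eq//; exact: Jfree.
have I0 : 0 <= (0 : R) <= 1 by rewrite lexx ler01.
have I1 : 0 <= (1 : R) <= 1 by rewrite lexx ler01.
have := fE 0 I0; have := fE 1 I1; rewrite /J scale1r scale0r addr0 => <- <-.
rewrite -lerBlDl.
pose df (t : R) := 2 * dot (nu - W t) (hess (x + t *: v) v (xi t)).
apply: (MVT_le f df) => t tI; have [Ut vl] := seg t tI.
  have Jd := derivableP (derivable_jac x v t Ut).
  have Gd := is_derive_mulmx _ _ _ _ _ Jd (is_derive_trmx _ _ _ Jd).
  have Gu : \det (G t) != 0.
    by rewrite -unitfE -unitmxE; exact: gram_unit (Jfree t tI).
  have Gid := derivableP (derivable_det_adj G t Gu (ltac:(by case: Gd))).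
  have xid := is_derive_mulmx _ _ _ _ _ (is_derive_mulmx _ _ _ _ _
    (is_derive_cst nu t 1) (is_derive_trmx _ _ _ Jd)) Gid.
  move: xid; set dxi := (X in is_derive _ _ _ X) => xid.
  have Wd : is_derive t 1 W (dxi *m J t + hess (x + t *: v) v (xi t)).
    have -> : hess (x + t *: v) v (xi t) = xi t *m 'D_1 J t.
      have [_ <-] := is_derive_jac x v (xi t) t Ut.
      have [_] := is_derive_mulmx _ _ _ _ _ (is_derive_cst (xi t) t 1) Jd.
      by rewrite mul0mx add0r.
    exact: is_derive_mulmx _ _ _ _ _ xid Jd.
  have := is_derive_subr _ _ _ _ _ (is_derive_mulr _ _ _ _ _ (is_derive_cst (2 : R) t 1)
    (is_derive_dot _ _ _ _ _ (is_derive_cst nu t 1) Wd))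
    (is_derive_dot _ _ _ _ _ Wd Wd).
  move=> H; apply: (is_derive_eq H); rewrite /df mul0r add0r dot0l add0r.
  rewrite (dotC _ (W t)) dotDr (dotDr _ _ (W t)) dotBl.
  have := tangent_part_orth _ nu dxi (Jfree t tI); rewrite -WE// dotBl => /subr0_eq ->.
  by rewrite /cst; lra.
rewrite /df -mulrA ler_pM2l ?ltr0n//.
rewrite WE// /hess dotC dot_suml.
under eq_bigr do rewrite dot_suml.
under eq_bigr do under eq_bigr do rewrite dotZl dotC dot_normal//.
rewrite (le_trans (bilinear_form_bound (J t) _ nu K v (xi t) (Jfree t tI) nu1 K0 _))//.
  by have := AK _ Ut; rewrite /second_form_sqnorm /first_form (jacobianE _ _ (dX _ Ut)).
rewrite -mulrA ler_wpM2l// -[leRHS]mulr1 ler_pM ?enorm_ge0//.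
by rewrite xiE// -/(tangent_part (J t) nu) -nu1 enorm_tangent_part//; exact: Jfree.
Qed.

Lemma no_local_max (a b : 'rV[R]_n.+1) (x : 'rV[R]_n) (rho : R) : (0 < n)%N ->
  0 < rho -> (forall y, `|y - x| < rho -> U y) -> mean_curvature X x = 0 ->
  (forall y, `|y - x| < rho ->
    dot (X y - a) (X y - a) - dot (X y - b) (X y - b) / 2 <=
    dot (X x - a) (X x - a) - dot (X x - b) (X x - b) / 2) -> False.
Proof.
move=> n0 rho0 xU Hx xmax.
have Ux : U x by apply: xU; rewrite subrr normr0.
have Jfree := freeX _ Ux.
pose g (y : 'rV[R]_n) := X y - (2 *: a - b).
have test v : dot (g x) (v *m jac X x) = 0 /\
    dot (v *m jac X x) (v *m jac X x) + dot (g x) (hess x v v) <= 0.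
  have [d d0 hd] : exists2 d, 0 < d & forall t : R, `|t| < d -> `|x + t *: v - x| < rho.
    exists (rho / (1 + `|v|)) => [|t]; first by rewrite divr_gt0// ltr_pwDl.
    rewrite ltr_pdivlMr ?ltr_pwDl// (addrC x) addrK normrZ mulrDr mulr1.
    by apply: le_lt_trans; rewrite lerDr.
  pose h (t : R) := dot (X (x + t *: v) - a) (X (x + t *: v) - a) -
    dot (X (x + t *: v) - b) (X (x + t *: v) - b) / 2.
  pose h1 (t : R) := dot (g (x + t *: v)) (v *m jac X (x + t *: v)).
  have Xd (t : R) (c : 'rV[R]_n.+1) : `|t| < d ->
      is_derive t 1 (fun s : R => X (x + s *: v) - c) (v *m jac X (x + t *: v)).
    move=> /hd/xU Ut; have := is_deriveB (is_derive_comp_line X x v t (dX _ Ut))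
      (is_derive_cst c t 1).
    by rewrite subr0 (jacobianE _ _ (dX _ Ut)).
  have x0 : x + (0 : R) *: v = x by rewrite scale0r addr0.
  have hd1 (t : R) : `|t| < d -> is_derive t 1 h (h1 t).
    move=> td.
    have H := is_derive_subr _ _ _ _ _ (is_derive_dot _ _ _ _ _ (Xd t a td) (Xd t a td))
      (is_derive_mulr _ _ _ _ _ (is_derive_dot _ _ _ _ _ (Xd t b td) (Xd t b td))
        (is_derive_cst (2^-1 : R) t 1)).
    apply: (is_derive_eq H); rewrite mulr0 addr0 /h1 /g.
    by rewrite !(dotC (v *m _)) !dotBl dotZl /cst; lra.
  have h1d : is_derive (0 : R) 1 h1
      (dot (v *m jac X x) (v *m jac X x) + dot (g x) (hess x v v)).
    have d00 : `|0 : R| < d by rewrite normr0.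
    have U0 : U (x + (0 : R) *: v) by rewrite x0.
    have := is_derive_dot _ _ _ _ _ (Xd 0 (2 *: a - b) d00) (is_derive_jac x v v 0 U0).
    by rewrite x0.
  have hm (t : R) : `|t| < d -> h t <= h 0.
    by move=> td; rewrite /h x0; apply: xmax; exact: hd.
  have := second_derivative_test h h1 _ d d0 hd1 h1d hm.
  by rewrite /h1 x0.
have g_normal : tangent_part (jac X x) (g x) = 0.
  by apply: dot_eq0; rewrite -dot_tangent_part//; exact: (test _).1.
pose J := jac X x.
pose B := invmx (J *m J^T) *m J.
have sum1 : \sum_k dot (row k B^T *m J) (row k B^T *m J) = n%:R.
  have -> : \sum_k dot (row k B^T *m J) (row k B^T *m J) =
      \tr (B^T *m J *m (B^T *m J)^T).
    apply: eq_bigr => k _; rewrite -row_mul; move: (B^T *m J) => A.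
    by rewrite dotE mxE; apply: eq_bigr => j _; rewrite !mxE.
  have -> : B^T *m J *m (B^T *m J)^T = B^T *m J.
    have gB : J *m J^T *m B = J by rewrite /B mulmxA mulmxV ?gram_unit// mul1mx.
    by rewrite [(B^T *m J)^T]trmx_mul trmxK -mulmxA (mulmxA J) gB.
  rewrite mxtrace_mulC /B trmx_mul trmx_inv gram_sym mulmxA.
  by rewrite mulmxV ?gram_unit// mxtrace1.
have sum2 : \sum_k dot (g x) (hess x (row k B^T) (row k B^T)) = 0.
  have -> : \sum_k dot (g x) (hess x (row k B^T) (row k B^T)) =
      \sum_i \sum_j (B *m B^T) i j * dot (g x) (partial i (partial j X) x).
    under eq_bigr do rewrite /hess dotC dot_suml.
    rewrite exchange_big/=; apply: eq_bigr => i _.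
    under eq_bigr do rewrite dot_suml.
    rewrite exchange_big/=; apply: eq_bigr => j _.
    rewrite [(B *m B^T) i j]mxE mulr_suml; apply: eq_bigr => k _.
    by rewrite dotZl (dotC (g x)) !mxE.
  rewrite (dual_frame _ Jfree).
  transitivity (dot (g x) (mean_curvature X x)); last by rewrite Hx dotC dot0l.
  rewrite /mean_curvature /first_form (jacobianE _ _ (dX _ Ux)) dotC dot_suml.
  apply: eq_bigr => i _; rewrite dot_suml; apply: eq_bigr => j _.
  by rewrite dotZl (dotC (second_form X x i j)) -dot_normal// g_normal subr0.
have : \sum_k (dot (row k B^T *m J) (row k B^T *m J) +
    dot (g x) (hess x (row k B^T) (row k B^T))) <= 0.
  by apply: sumr_le0 => k _; exact: (test _).2.
by rewrite big_split/= sum1 sum2 addr0 leNgt ltr0n n0.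
Qed.

End ChartGeometry.

(** * Paths and completeness *)

Section Chains.
Context {R : realType} {n : nat} {M : manifold R n} {F : M -> 'rV[R]_n.+1}.
Hypothesis F_imm : immersion F.

Notation Xof c := (F \o cinv c).

Section ChartRegularity.
Variable c : chart R n M.
Hypothesis Ac : atlas c.

Lemma chart_differentiable x : ccod c x -> differentiable (Xof c) x.
Proof. by have [sm _] := F_imm _ Ac; have [h _] := sm 1%N; exact: h. Qed.

Lemma chart_partial_differentiable i x :
  ccod c x -> differentiable (partial i (Xof c)) x.
Proof.
by have [sm _] := F_imm _ Ac; have [_ /(_ i)[h _]] := sm 2%N; exact: h.
Qed.

Lemma chart_partial_continuous i x :
  ccod c x -> {for x, continuous (partial i (Xof c))}.
Proof.
by move=> /(chart_partial_differentiable i)/differentiable_continuous.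
Qed.

Lemma chart_row_free x : ccod c x -> row_free (jac (Xof c) x).
Proof.
move=> Ux; rewrite -jacobianE; last exact: chart_differentiable.
by have [_ h] := F_imm _ Ac; exact: h.
Qed.

End ChartRegularity.

Definition segment_cost (c : chart R n M) (x v : 'rV[R]_n) (l : R) : Prop :=
  forall t : R, 0 <= t <= 1 ->
    ccod c (x + t *: v) /\ enorm (v *m jac (Xof c) (x + t *: v)) <= l.

(* Polygonal paths, straight in charts.  A bound on the speed of each piece
   replaces its length, so that pieces can be cut and reversed without
   integrals. *)
Inductive chain : M -> M -> R -> Prop :=
| chain_nil p l : 0 <= l -> chain p p l
| chain_cons c x v l q m : atlas c -> segment_cost c x v l ->
    chain (cinv c (x + v)) q m -> chain (cinv c x) q (l + m).

Lemma segment_cost_ge0 c x v l : segment_cost c x v l -> 0 <= l.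
Proof.
move=> /(_ 0)[|_]; first by rewrite lexx ler01.
exact/le_trans/enorm_ge0.
Qed.

Lemma segment_cost_start c x v l : segment_cost c x v l -> ccod c x.
Proof. by move=> /(_ 0)[|]; rewrite ?lexx ?ler01// scale0r addr0. Qed.

Lemma segment_cost_end c x v l : segment_cost c x v l -> ccod c (x + v).
Proof. by move=> /(_ 1)[|]; rewrite ?lexx ?ler01// scale1r. Qed.

Lemma segment_cost_sub c x v l a b : segment_cost c x v l -> 0 <= a -> 0 <= b ->
  a + b <= 1 -> segment_cost c (x + a *: v) (b *: v) (b * l).
Proof.
move=> seg a0 b0 ab t /andP[t0 t1].
have [|Ut vl] := seg (a + t * b).
  rewrite addr_ge0 ?mulr_ge0//=; apply: le_trans ab.
  by rewrite lerD2l ler_piMl.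
rewrite scalerA -addrA -scalerDl; split=> //.
by rewrite -scalemxAl enormZ ger0_norm// ler_wpM2l.
Qed.

Lemma segment_cost_rev c x v l : segment_cost c x v l ->
  segment_cost c (x + v) (- v) l.
Proof.
move=> seg t /andP[t0 t1].
have [|Ut vl] := seg (1 - t); first by rewrite subr_ge0 t1 lerBlDr lerDl.
have -> : x + v + t *: - v = x + (1 - t) *: v.
  by apply/rowP => i; rewrite !mxE; ring.
by split=> //; rewrite mulNmx enormN.
Qed.

Lemma chain_ge0 p q l : chain p q l -> 0 <= l.
Proof.
by elim=> // c x v l' q' m _ /segment_cost_ge0 l0 _ m0; rewrite addr_ge0.
Qed.

Lemma chain_le p q l l' : chain p q l -> l <= l' -> chain p q l'.
Proof.
move=> pq; elim: pq l' => [{}p {}l l0 l' ll'|c x v l1 {}q m Ac seg _ ih l' ll'].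
  by apply: chain_nil; exact: le_trans ll'.
have -> : l' = l1 + (l' - l1) by rewrite addrC subrK.
by apply: chain_cons seg _ => //; apply: ih; rewrite lerBrDl.
Qed.

Lemma chain_trans p q s l l' : chain p q l -> chain q s l' -> chain p s (l + l').
Proof.
move=> pq; elim: pq s l' => [{}p {}l l0 s l' ps|c x v l1 {}q m Ac seg _ ih s l' qs].
  by apply: chain_le ps _; rewrite lerDr.
by rewrite -addrA; apply: chain_cons seg _ => //; exact: ih.
Qed.

Lemma chain_segment c x v l : atlas c -> segment_cost c x v l ->
  chain (cinv c x) (cinv c (x + v)) l.
Proof.
move=> Ac seg; rewrite -[l]addr0; apply: chain_cons seg _ => //.
exact: chain_nil.
Qed.

Lemma chain_sym p q l : chain p q l -> chain q p l.
Proof.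
elim=> [{}p {}l l0|c x v l1 {}q m Ac seg _ ih]; first exact: chain_nil.
rewrite addrC; apply: chain_trans ih _.
have := chain_segment _ _ _ _ Ac (segment_cost_rev _ _ _ _ seg).
by rewrite addrK.
Qed.

Lemma chain_split p q l s : chain p q l -> 0 <= s <= l ->
  exists2 w, chain p w s & chain w q (l - s).
Proof.
move=> pq; elim: pq s => [{}p {}l l0 s /andP[s0 sl]|c x v l1 {}q m Ac seg yq ih s].
  by exists p; apply: chain_nil; rewrite ?subr_ge0.
move=> /andP[s0 sl]; have l10 := segment_cost_ge0 _ _ _ _ seg.
have [sl1|l1s] := leP s l1; last first.
  have [|w yw wq] := ih (s - l1); first by rewrite subr_ge0 ltW//= lerBlDl.
  exists w; last by apply: chain_le wq _; lra.
  have -> : s = l1 + (s - l1) by lra.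
  exact: chain_cons Ac seg yw.
have [l1E|l1N] := eqVneq l1 0.
  have -> : s = 0 by apply/eqP; rewrite eq_le s0 -l1E sl1.
  exists (cinv c x); first exact: chain_nil.
  by rewrite subr0; exact: chain_cons Ac seg yq.
have l1p : 0 < l1 by rewrite lt_def l1N.
pose a := s / l1.
have a0 : 0 <= a by rewrite divr_ge0.
have a1 : a <= 1 by rewrite ler_pdivrMr// mul1r.
have al : a * l1 = s by rewrite divfK.
exists (cinv c (x + a *: v)).
  have := segment_cost_sub _ _ _ _ 0 a seg (lexx 0) a0.
  rewrite add0r scale0r addr0 => /(_ a1); rewrite al; exact: chain_segment.
have := segment_cost_sub _ _ _ _ a (1 - a) seg a0.
rewrite subr_ge0 addrC subrK => /(_ a1 (lexx 1)) seg'.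
have -> : l1 + m - s = (1 - a) * l1 + m by rewrite mulrBl al mul1r addrAC.
apply: chain_cons Ac seg' _.
by rewrite -addrA -scalerDl (addrC a) subrK scale1r.
Qed.

Lemma chain_lipschitz p q l : chain p q l -> enorm (F p - F q) <= l.
Proof.
elim=> [{}p {}l l0|c x v l1 {}q m Ac seg _ ih]; first by rewrite subrr enorm0.
rewrite (le_trans (enorm_triangle (F (cinv c (x + v))) _ _))// lerD//.
rewrite enormBC.
have := enorm_MVT (fun t : R => Xof c (x + t *: v))
  (fun t => v *m jac (Xof c) (x + t *: v)) l1.
rewrite /= scale1r scale0r addr0; apply => t /seg[Ut vl] //.
rewrite -jacobianE; last exact: chart_differentiable.
by apply: is_derive_comp_line; exact: chart_differentiable.
Qed.

Lemma chart_ball (c : chart R n M) x0 : atlas c -> ccod c x0 ->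
  exists rho B kap : R, [/\ 0 < rho, 0 < B, 0 < kap &
    [/\ forall x, `|x - x0| < rho -> ccod c x,
      forall x y, `|x - x0| < rho -> `|y - x0| < rho ->
        chain (cinv c x) (cinv c y) (B * `|y - x|) &
      forall x y, `|x - x0| < rho -> `|y - x0| < rho ->
        kap * `|y - x| <= enorm (F (cinv c y) - F (cinv c x))]].
Proof.
move=> Ac Ux0.
have dX := chart_differentiable c Ac.
have cX := chart_partial_continuous c Ac.
have [r1 [B [r10 B0 r1U r1B]]] := jacobian_bounded_near (@ccod_open _ _ _ c) dX cX x0 Ux0.
have [k k0 kX] := row_free_lower_bound _ (chart_row_free c Ac x0 Ux0).
have [|r2 r20 [r2U r2X]] := local_expansion (@ccod_open _ _ _ c) dX cX _ 1%:M x0 k Ux0 k0.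
  by move=> v; rewrite mulmx1.
exists (Num.min r1 r2), B, (k / 2); split=> //; first by rewrite lt_min r10.
  by rewrite divr_gt0.
split=> [x|x y|x y]; rewrite !lt_min.
- by move=> /andP[/r1U].
- move=> /andP[xr _] /andP[yr _].
  have -> : y = x + (y - x) by rewrite addrC subrK.
  apply: chain_segment => // t tI; rewrite [x + (y - x)]addrC subrK.
  have seg := normr_segment_lt _ _ _ _ _ tI xr yr.
  by split; [exact: r1U|exact: r1B].
- move=> /andP[_ xr] /andP[_ yr].
  by have := r2X x y xr yr; rewrite mulmx1.
Qed.

End Chains.
Arguments chain {R n M} F.
Arguments segment_cost {R n M} F.

Lemma near_continuous {R : realType} {k : nat} (f h : R -> 'rV[R]_k) (t : R) :
  (\forall s \near t, f s = h s) -> {for t, continuous h} -> {for t, continuous f}.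
Proof.
move=> fh hc; have ft : f t = h t := nbhs_singleton fh.
rewrite /prop_for /continuous_at ft.
apply: cvg_trans hc; apply: near_eq_cvg.
by apply: filterS fh => s ->.
Qed.

Lemma continuous_jac_comp {R : realType} {n k : nat} (X : 'rV[R]_n -> 'rV[R]_k)
    (v g : R -> 'rV[R]_n) (t : R) :
  (forall i, {for g t, continuous (partial i X)}) ->
  {for t, continuous v} -> {for t, continuous g} ->
  {for t, continuous (fun s => v s *m jac X (g s))}.
Proof.
move=> cX cv cg.
have -> : (fun s => v s *m jac X (g s)) =
    (fun s => \sum_i v s 0 i *: partial i X (g s)).
  by apply/funext => s; rewrite mulmx_jac.
rewrite /prop_for /continuous_at.
apply: cvg_big => [|i _]; first exact: add_continuous.
apply: cvgZ.
  exact: (@cvg_comp _ _ _ v (fun w : 'rV[R]_n => w 0 i) _ _ _ cv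
    (@coord_continuous _ _ _ 0 i _)).
exact: (@cvg_comp _ _ _ g (partial i X) _ _ _ cg (cX i)).
Qed.

Section Arcs.
Context {R : realType} {n : nat} {M : manifold R n} {F : M -> 'rV[R]_n.+1}.
Hypothesis F_imm : immersion F.
Notation Xof c := (F \o cinv c).

Lemma arc_derivative (g : R -> M) : C1_arc g -> exists2 e : R, 0 < e &
  forall t : R, - e < t < 1 + e ->
    derivable (F \o g) t 1 /\ {for t, continuous (derive1 (F \o g))}.
Proof.
move=> [e e0 ge]; exists e => // t tI.
have [c Ac cgt] := atlas_cover (g t).
have [gc gcE] := ge t tI.
have near_c : \forall s \near t, (- e < s < 1 + e) /\ cdom c (g s).
  have tI' : t \in `]- e, 1 + e[ by rewrite in_itv.
  have near_I : \forall s \near t, - e < s < 1 + e.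
    by apply: filterS (near_in_itvoo tI') => s; rewrite in_itv.
  exact: filterI near_I (gc _ (open_nbhs_nbhs (conj (@cdom_open _ _ _ c) cgt))).
have near_der : \forall s \near t,
    is_derive (s : R) 1 (F \o g) (derive1 (cmap c \o g) s *m jac (Xof c) (cmap c (g s))).
  apply: filterS (near_join near_c) => s near_s.
  have [sI cgs] := nbhs_singleton near_s.
  have [_ /(_ c Ac cgs)[dcg _]] := ge s sI.
  have Us : ccod c (cmap c (g s)) by exact: cmap_cod.
  have ds : is_derive s 1 (cmap c \o g) (derive1 (cmap c \o g) s).
    by rewrite derive1E; exact: derivableP.
  have dXs := chart_differentiable F_imm c Ac _ Us.
  have := is_derive_comp_diff (Xof c) (cmap c \o g) s _ ds dXs.
  rewrite (jacobianE _ _ dXs).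
  apply: near_eq_is_derive; apply: filterS near_s => r [_ cgr] /=.
  by rewrite cmapK.
split; first by have [] := nbhs_singleton near_der.
apply: (near_continuous _ (fun s => derive1 (cmap c \o g) s *m
    jac (Xof c) (cmap c (g s)))).
  by apply: filterS near_der => s [_ <-]; rewrite derive1E.
have [dcg ddcg] := gcE c Ac cgt.
apply: continuous_jac_comp => //.
- by move=> i; apply: chart_partial_continuous => //; exact: cmap_cod.
- by move: dcg => /derivable1_diffP/differentiable_continuous.
Qed.

Lemma enorm_comp_continuous {k : nat} (f : R -> 'rV[R]_k) (t : R) :
  {for t, continuous f} -> {for t, continuous (fun s => enorm (f s))}.
Proof.
move=> fc; have := @cvg_comp _ _ _ f (fun u => enorm (u - 0)) _ _ _ fc
  (enormB_continuous 0 (f t)).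
by under eq_fun do rewrite subr0; rewrite subr0.
Qed.

Lemma within_continuous_itv (f : R -> R) (a b : R) :
  (forall t, a <= t <= b -> {for t, continuous f}) -> {within `[a, b], continuous f}.
Proof.
move=> fc; apply: continuous_in_subspaceT => t /set_mem /=.
by rewrite in_itv/=; exact: fc.
Qed.

Lemma arc_length_ge (g : R -> M) (a b : R) : C1_arc g -> 0 <= a -> a <= b -> b <= 1 ->
  enorm (F (g b) - F (g a)) <= arc_length F g.
Proof.
move=> /arc_derivative[e e0 ge] a0 ab b1.
have I01 (t : R) : 0 <= t <= 1 -> - e < t < 1 + e.
  by move=> /andP[t0 t1]; apply/andP; split; lra.
pose D := derive1 (F \o g).
have Dc (t : R) : 0 <= t <= 1 -> {for t, continuous (fun s => enorm (D s))}.
  by move=> /I01/ge[_ h]; exact: enorm_comp_continuous.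
have Dint : (@lebesgue_measure R).-integrable `[0, 1] (EFin \o (fun s => enorm (D s))).
  apply: continuous_compact_integrable; first exact: segment_compact.
  exact: within_continuous_itv.
have L0 : 0 <= arc_length F g.
  by apply: Rintegral_ge0 => t _; exact: enorm_ge0.
apply: enorm_le_dot => // w w1.
move: ab; rewrite le_eqVlt => /predU1P[->|ab]; first by rewrite subrr dot0l.
pose s (t : R) := dot (F (g t)) w.
pose ds (t : R) := dot (D t) w.
have sd (t : R) : 0 <= t <= 1 -> is_derive t 1 s (ds t).
  move=> /I01/ge[dFg _].
  have dd : is_derive t 1 (F \o g) (D t) by rewrite /D derive1E; exact: derivableP.
  have := is_derive_dot _ _ _ _ _ dd (is_derive_cst w t 1).
  by rewrite [X in _ + X]dotC dot0l addr0.
have sub t : a <= t <= b -> 0 <= t <= 1.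
  by move=> /andP[at_ tb]; rewrite (le_trans a0)//= (le_trans tb).
have dsc (t : R) : 0 <= t <= 1 -> {for t, continuous ds}.
  move=> /I01/ge[_ Dct].
  exact: (@cvg_comp _ _ _ D (fun u => dot u w) _ _ _ Dct (dotl_continuous w (D t))).
have FTC : (\int[@lebesgue_measure R]_(x in `[a, b]) (ds x)%:E =
    (s b)%:E - (s a)%:E)%E.
  apply: continuous_FTC2 => //.
  - by apply: within_continuous_itv => t /sub; exact: dsc.
  - have sc t : a <= t <= b -> {for t, continuous s}.
      by move=> /sub/sd[h _]; exact: derivable_continuous.
    split=> [t||].
    + rewrite in_itv/= => /andP[at_ tb].
      by have [] := sd t (sub t (ltac:(by rewrite !ltW))).
    + by apply: cvg_at_right_filter; apply: sc; rewrite lexx ltW.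
    + by apply: cvg_at_left_filter; apply: sc; rewrite lexx ltW.
  - move=> t; rewrite in_itv/= => /andP[at_ tb].
    by rewrite derive1E; have [_] := sd t (sub t (ltac:(by rewrite !ltW))).
rewrite dotBl -lee_fin EFinB -FTC.
have -> : (arc_length F g)%:E =
    (\int[@lebesgue_measure R]_(t in `[0%R, 1%R]) (enorm (D t))%:E)%E.
  by rewrite /arc_length /Rintegral fineK//; exact: integrable_fin_num.
apply: (@le_trans _ _ (\int[@lebesgue_measure R]_(t in `[a, b]) (enorm (D t))%:E)%E).
  have dsint : (@lebesgue_measure R).-integrable `[a, b] (EFin \o ds).
    apply: continuous_compact_integrable; first exact: segment_compact.
    by apply: within_continuous_itv => t /sub; exact: dsc.
  have Dint' : (@lebesgue_measure R).-integrable `[a, b] (EFin \o (fun s => enorm (D s))).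
    apply: continuous_compact_integrable; first exact: segment_compact.
    by apply: within_continuous_itv => t /sub; exact: Dc.
  apply: le_integral => // t _; rewrite lee_fin /ds.
  by rewrite (le_trans (dot_le_enorm _ _))// w1 mulr1.
apply: ge0_subset_integral => //.
- by have /integrableP[] := Dint.
- by move=> t _; rewrite lee_fin enorm_ge0.
Qed.

Lemma arc_length_le (g : R -> M) (l : R) : C1_arc g ->
  (forall t, 0 <= t <= 1 -> enorm (derive1 (F \o g) t) <= l) -> arc_length F g <= l.
Proof.
move=> /arc_derivative[e e0 ge] gl.
have Dc (t : R) : 0 <= t <= 1 ->
    {for t, continuous (fun s => enorm (derive1 (F \o g) s))}.
  move=> /andP[t0 t1]; have [|_ h] := ge t; first by apply/andP; split; lra.
  exact: enorm_comp_continuous.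
have -> : l = \int[@lebesgue_measure R]_(t in `[0, 1]) l.
  have mu01 : lebesgue_measure (`[0, 1]%classic : set R) = 1%:E.
    by rewrite lebesgue_measure_itv/= lte_fin ltr01 oppr0 adde0.
  by rewrite Rintegral_cst// [X in fine X](_ : _ = 1%:E)/= ?mulr1.
apply: le_Rintegral => //.
- apply: continuous_compact_integrable; first exact: segment_compact.
  exact: within_continuous_itv.
- apply: continuous_compact_integrable; first exact: segment_compact.
  by apply: within_continuous_itv => t _; exact: cst_continuous.
Qed.

Lemma line_continuous {k : nat} (x v : 'rV[R]_k) (t : R) :
  {for t, continuous (fun s : R => x + s *: v)}.
Proof.
have [h _] := is_derive_line x v t.
by move: h => /derivable1_diffP/differentiable_continuous.
Qed.

Lemma segment_arc c x v l : atlas c -> segment_cost F c x v l ->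
  C1_arc (fun t : R => cinv c (x + t *: v)) /\
  arc_length F (fun t : R => cinv c (x + t *: v)) <= l.
Proof.
move=> Ac seg; set g := fun t : R => _.
have [r1 r10 h1] := open_ball_inside _ _ (@ccod_open _ _ _ c)
  (segment_cost_start _ _ _ _ seg).
have [r2 r20 h2] := open_ball_inside _ _ (@ccod_open _ _ _ c)
  (segment_cost_end _ _ _ _ seg).
pose r := Num.min r1 r2.
have r0 : 0 < r by rewrite lt_min r10.
have v0 : 0 < 1 + `|v| by rewrite ltr_pwDl.
pose e := r / (1 + `|v|).
have e0 : 0 < e by rewrite divr_gt0.
have small (s : R) : `|s| < e -> `|s *: v| < r.
  rewrite /e ltr_pdivlMr// mulrDr mulr1 normrZ; apply: le_lt_trans.
  by rewrite lerDr.
have codt (t : R) : - e < t < 1 + e -> ccod c (x + t *: v).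
  move=> /andP[et te]; have [t0|t0] := ltP t 0.
    apply: h1; rewrite addrC addKr (lt_le_trans (small t _))// ?ge_min ?lexx//.
    by rewrite ltr0_norm// ltrNl.
  have [t1|t1] := leP t 1; first by have [] := seg t (ltac:(by rewrite t0)).
  apply: h2; have -> : x + t *: v - (x + v) = (t - 1) *: v.
    by apply/rowP => i; rewrite !mxE; ring.
  rewrite (lt_le_trans (small _ _))// ?ge_min ?lexx ?orbT//.
  by rewrite gtr0_norm ?subr_gt0// ltrBlDl.
have gc (t : R) : - e < t < 1 + e -> {for t, continuous g}.
  move=> /codt Ut.
  exact: (@cvg_comp _ _ _ (fun s : R => x + s *: v) (cinv c) _ _ _
    (line_continuous x v t) (cinv_continuous Ut)).
have arcg : C1_arc g.
  exists e => // t tI; split; first exact: gc.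
  move=> d Ad dgt.
  pose tau := cmap d \o cinv c.
  have sm := atlas_compatible Ac Ad.
  have [dtau ctau] := sm 1%N.
  have nearV : \forall s \near t, (ccod c `&` cinv c @^-1` cdom d) (x + s *: v).
    apply: filterI.
      apply: (line_continuous x v t).
      exact: open_nbhs_nbhs (conj (@ccod_open _ _ _ c) (codt _ tI)).
    apply: (gc t tI).
    exact: open_nbhs_nbhs (conj (@cdom_open _ _ _ d) dgt).
  have nearD : \forall s \near t,
      is_derive (s : R) 1 (cmap d \o g) (v *m jac tau (x + s *: v)).
    apply: filterS nearV => s Vs; have dts := dtau _ Vs.
    by rewrite -(jacobianE _ _ dts); exact: is_derive_comp_line.
  split; first by have [] := nbhs_singleton nearD.
  apply: (near_continuous _ (fun s : R => v *m jac tau (x + s *: v))).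
    by apply: filterS nearD => s [_ <-]; rewrite derive1E.
  apply: continuous_jac_comp; last exact: line_continuous.
    by move=> i; apply: ctau; exact: nbhs_singleton nearV.
  exact: cst_continuous.
split=> //; apply: arc_length_le => // t tI.
have [Ut vl] := seg t tI.
have dXt := chart_differentiable F_imm c Ac _ Ut.
rewrite derive1E; have [_] := is_derive_comp_line (Xof c) x v t dXt.
by rewrite (jacobianE _ _ dXt) => ->.
Qed.

Lemma chain_path p q l : chain F p q l -> exists2 l', pw_C1_path F p q l' & l' <= l.
Proof.
elim=> [{}p {}l l0|c x v l1 {}q m Ac seg _ [m' qm mm]].
  by exists 0 => //; exact: pw_C1_nil.
have [arcg gl] := segment_arc _ _ _ _ Ac seg.
exists (arc_length F (fun t : R => cinv c (x + t *: v)) + m'); last exact: lerD.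
have := @pw_C1_cons _ _ _ F (fun t : R => cinv c (x + t *: v)) q m' arcg.
by rewrite scale1r scale0r addr0; apply.
Qed.

Lemma riemannian_dist_chain p q l : chain F p q l -> (riemannian_dist F p q <= l%:E)%E.
Proof.
move=> /chain_path[l' pq ll]; apply: (@le_trans _ _ l'%:E); last by rewrite lee_fin.
by apply: ereal_inf_lbound; exists l'.
Qed.

Lemma closed_chart_ball (c : chart R n M) x0 (rho : R) :
  (forall x, `|x - x0| <= rho -> ccod c x) ->
  closed (cinv c @` [set x | `|x - x0| <= rho]).
Proof.
move=> rU; apply: compact_closed; first exact: carrier_hausdorff.
apply: continuous_compact.
  apply: continuous_in_subspaceT => x /set_mem /= xr.
  exact/cinv_continuous/rU.
apply: bounded_closed_compact.
  exists (`|x0| + rho); split; first exact: num_real.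
  move=> y yM x /= xr; apply: le_trans (ltW yM).
  by rewrite -lerBlDl (le_trans (lerB_dist _ _)).
have -> : [set x : 'rV[R]_n | `|x - x0| <= rho] = closed_ball_ (fun x => `|x|) x0 rho.
  by apply/seteqP; split => x /=; rewrite distrC.
exact: closed_closed_ball_.
Qed.

(* A path ending at [cinv c x0] that is too short to cross the shell of the
   chart ball stays inside it. *)
Lemma short_path_in_chart (c : chart R n M) x0 (rho kap : R) :
  atlas c -> 0 < rho -> 0 < kap ->
  (forall x, `|x - x0| <= rho -> ccod c x) ->
  (forall x, `|x - x0| <= rho ->
    kap * `|x - x0| <= enorm (F (cinv c x) - F (cinv c x0))) ->
  forall p q l, pw_C1_path F p q l -> q = cinv c x0 -> l < kap * rho ->
  [/\ cdom c p, `|cmap c p - x0| < rho & enorm (F p - F q) <= l].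
Proof.
move=> Ac rho0 kap0 rU kapF p q l; elim=> [{}p pE l0|g {}q {}l arcg _ ih qE lr].
  have U0 : ccod c x0 by apply: rU; rewrite subrr normr0 ltW.
  by rewrite subrr enorm0 pE cinvK// subrr normr0; split=> //; exact: cinv_dom.
have L0 : 0 <= arc_length F g by apply: Rintegral_ge0 => t _; exact: enorm_ge0.
have [|c1 r1 F1] := ih qE; first by lra.
pose O := [set p | cdom c p /\ `|cmap c p - x0| < rho].
pose K := cinv c @` [set x | `|x - x0| <= rho].
have KO (t : R) : 0 <= t <= 1 -> K (g t) -> O (g t).
  move=> /andP[t0 t1] [x /= xr gtE].
  have Ux := rU _ xr.
  split; rewrite -gtE; first exact: cinv_dom.
  rewrite cinvK// -(ltr_pM2l kap0) (le_lt_trans (kapF _ xr))//.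
  rewrite (le_lt_trans _ lr)// gtE -qE (le_trans (enorm_triangle (F (g 1)) _ _))//.
  by rewrite lerD// enormBC; exact: arc_length_ge.
have OK (t : R) : O (g t) -> K (g t).
  by move=> [ct rt]; exists (cmap c (g t)); rewrite /= ?ltW// cmapK.
have oO : open O.
  rewrite openE => y [cy ry]; rewrite /interior.
  have nb : \forall z \near y, cdom c z.
    exact: open_nbhs_nbhs (conj (@cdom_open _ _ _ c) cy).
  have nr : \forall z \near y, `|cmap c z - x0| < rho.
    have d0 : 0 < rho - `|cmap c y - x0| by rewrite subr_gt0.
    have nd : \forall z \near y, `|cmap c y - cmap c z| < rho - `|cmap c y - x0|.
      exact: (cmap_continuous cy (near_dist_lt _ _ d0)).
    apply: filterS nd => z /=.
    have := ler_distD (cmap c y) (cmap c z) x0.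
    by rewrite (distrC (cmap c z) (cmap c y)); lra.
  exact: filterI nb nr.
have [e e0 ge] := arcg.
have gc (t : R) : 0 <= t <= 1 -> {for t, continuous g}.
  move=> /andP[t0 t1]; have [|//] := ge t; apply/andP; split; lra.
have all01 : `[0, 1]%classic `&` g @^-1` O = `[0, 1]%classic :> set R.
  apply: (@segment_connected R 0 1).
  - by exists 1; split=> //=; rewrite in_itv/= lexx ler01.
  - exists (interior (g @^-1` O)); first exact: open_interior.
    apply/seteqP; split=> t [/= tI gtO]; split=> //; last exact: interior_subset gtO.
    rewrite in_itv/= in tI.
    apply: (gc t tI); exact: open_nbhs_nbhs.
  - exists (closure (`[0, 1]%classic `&` g @^-1` K)); first exact: closed_closure.
    apply/seteqP; split=> t [/= tI gtO]; split=> //.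
      by apply: subset_closure; split=> //; exact: OK.
    rewrite in_itv/= in tI.
    apply: KO => //; apply: closed_chart_ball => //.
    move=> B /(gc t tI) gB; have [s [[_ Kgs] Bs]] := gtO _ gB.
    by exists (g s).
have [_ [c0 r0]] : (`[0, 1]%classic `&` g @^-1` O) 0.
  by rewrite all01 /= in_itv/= lexx ler01.
split=> //; rewrite (le_trans (enorm_triangle (F (g 1)) _ _))// lerD//.
by rewrite enormBC; exact: arc_length_ge.
Qed.

Lemma chart_neighbourhood (c : chart R n M) x0 : atlas c -> ccod c x0 ->
  exists rho B kap : R, [/\ 0 < rho, 0 < B, 0 < kap &
    [/\ forall x, `|x - x0| < rho -> ccod c x,
      forall x y, `|x - x0| < rho -> `|y - x0| < rho ->
        chain F (cinv c x) (cinv c y) (B * `|y - x|) &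
      forall p l, pw_C1_path F p (cinv c x0) l -> l < kap * rho ->
        exists x, [/\ p = cinv c x, `|x - x0| < rho & kap * `|x - x0| <= l]]].
Proof.
move=> Ac U0.
have [r [B [kap [r0 B0 kap0 [rU rB rF]]]]] := chart_ball F_imm c x0 Ac U0.
have r20 : 0 < r / 2 by rewrite divr_gt0.
have sub (x : 'rV[R]_n) : `|x - x0| <= r / 2 -> `|x - x0| < r by lra.
have x00 : `|x0 - x0| < r by rewrite subrr normr0.
exists (r / 2), B, kap; split=> //; split.
- by move=> x /ltW/sub/rU.
- by move=> x y /ltW/sub xr /ltW/sub yr; exact: rB.
- move=> p l pl lr.
  have [|x xr|cp pr Fp] := short_path_in_chart c x0 (r / 2) kap Ac r20 kap0
    _ _ p _ l pl erefl lr.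
  + by move=> x /sub/rU.
  + by apply: rF => //; exact: sub.
  exists (cmap c p); rewrite cmapK//; split=> //.
  have := rF x0 _ x00 (sub _ (ltW pr)); rewrite cmapK// => h.
  exact: le_trans Fp.
Qed.

Lemma chain_complete : complete_hypersurface F ->
  complete_length_structure (chain F).
Proof.
move=> Fc; split.
- by move=> p; exact: chain_nil.
- exact: chain_ge0.
- exact: chain_sym.
- exact: chain_le.
- exact: chain_trans.
- exact: chain_split.
move=> u uC; have [e e0|p hp] := Fc u.
  have e2 : 0 < e / 2 by lra.
  have [N hN] := uC _ e2; exists N => i j Ni Nj.
  rewrite (le_lt_trans (riemannian_dist_chain _ _ _ (hN _ _ Ni Nj)))// lte_fin; lra.
exists p => e e0; have [c Ac cp] := atlas_cover p.
have [rho [B [kap [rho0 B0 kap0 [_ hB hk]]]]] := chart_neighbourhood c _ Ac (cmap_cod cp).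
rewrite cmapK// in hk.
pose d := Num.min (kap * rho) (kap * (e / B)).
have d0 : 0 < d by rewrite lt_min !mulr_gt0// invr_gt0.
have [N hN] := hp _ d0; exists N => i Ni.
have [_ [l il <-]] := ereal_inf_lt (hN _ Ni).
rewrite lte_fin lt_min => /andP[lr le].
have [x [-> xr xl]] := hk _ _ il lr.
have := hB x _ xr (_ : `|cmap c p - cmap c p| < rho).
rewrite subrr normr0 => /(_ rho0); rewrite cmapK// => /chain_le; apply.
rewrite distrC mulrC -ler_pdivlMr// ltW// -(ltr_pM2l kap0).
exact: le_lt_trans xl le.
Qed.

End Arcs.

(** * Projection along a normal *)

Section NormalLine.
Context {R : realType} {n : nat}.
Implicit Types (J : 'M[R]_(n, n.+1)) (u v w nu e : 'rV[R]_n.+1).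

Lemma exists_unit_normal J : exists2 N : 'rV[R]_n.+1, enorm N = 1 & N *m J^T = 0.
Proof.
have kerN0 : kermx J^T != 0.
  rewrite -mxrank_eq0 mxrank_ker subn_eq0 -ltnNge.
  exact: leq_ltn_trans (rank_leq_col _) (ltnSn n).
have [v vker v0] := rowV0Pn kerN0.
exists ((enorm v)^-1 *: v); first exact: enorm_unit.
by rewrite -scalemxAl (sub_kermxP vker) scaler0.
Qed.

Lemma normal_component J N v : row_free J -> enorm N = 1 -> N *m J^T = 0 ->
  v - tangent_part J v = dot v N *: N.
Proof.
move=> Jfree N1 NJ.
have vker : (v - tangent_part J v <= kermx J^T)%MS.
  apply/sub_kermxP; rewrite mulmxBl /tangent_part /tangent_coord -!mulmxA.
  by rewrite mulVmx ?gram_unit// mulmx1 subrr.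
have N0 : N != 0.
  by apply/eqP => N0; move: N1; rewrite N0 enorm0 => /eqP; rewrite eq_sym oner_eq0.
have kerN : (kermx J^T <= N)%MS.
  have Nker : (N <= kermx J^T)%MS by apply/sub_kermxP.
  rewrite -(geq_leqif (mxrank_leqif_sup Nker)).
  rewrite mxrank_ker mxrank_tr rank_rV N0.
  by move: Jfree; rewrite /row_free => /eqP ->; rewrite subSn// subnn.
have /sub_rVP[k vk] := submx_trans vker kerN.
rewrite vk; congr (_ *: _).
have TN : dot (tangent_part J v) N = 0 by rewrite /tangent_part dot_mulmx NJ dotC dot0l.
have := congr1 (fun u => dot u N) vk.
by rewrite dotBl TN subr0 dotZl -sqr_enorm N1 expr1n mulr1.
Qed.

Lemma tangent_part_pythagoras J N v : row_free J -> enorm N = 1 -> N *m J^T = 0 ->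
  dot (tangent_part J v) (tangent_part J v) = dot v v - dot v N ^+ 2.
Proof.
move=> Jfree N1 NJ; have vN := normal_component J N v Jfree N1 NJ.
have -> : dot v v - dot v N ^+ 2 = dot v (v - dot v N *: N).
  by rewrite dotBr dotZr expr2.
by rewrite -vN opprB addrC subrK dot_tangent_part.
Qed.

(* Bessel's inequality for the unit normal of [J] against the orthonormal pair
   [e], [nu]. *)
Lemma tangent_part_orthogonal_ge J e nu : row_free J -> enorm e = 1 -> enorm nu = 1 ->
  dot e nu = 0 ->
  1 - dot (tangent_part J nu) (tangent_part J nu) <= dot (tangent_part J e) (tangent_part J e).
Proof.
move=> Jfree e1 nu1 enu; have [N N1 NJ] := exists_unit_normal J.
rewrite !(tangent_part_pythagoras _ N)//.
have := dot_ge0 (N - dot e N *: e - dot nu N *: nu).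
rewrite !dotBl !dotBr !dotZl !dotZr -!sqr_enorm e1 nu1 N1 (dotC nu e) enu.
by rewrite (dotC N e) (dotC N nu); lra.
Qed.

Definition orthproj nu v := v - dot v nu *: nu.

Lemma orthprojE nu v : orthproj nu v = v *m (1%:M - nu^T *m nu).
Proof.
rewrite mulmxBr mulmx1 mulmxA; congr (_ - _).
by rewrite [v *m nu^T]mx11_scalar mul_scalar_mx.
Qed.

Lemma dot_orthproj nu v : enorm nu = 1 -> dot (orthproj nu v) nu = 0.
Proof. by move=> nu1; rewrite dotBl dotZl -sqr_enorm nu1 expr1n mulr1 subrr. Qed.

Lemma orthprojB nu u v : orthproj nu (u - v) = orthproj nu u - orthproj nu v.
Proof. by rewrite !orthprojE mulmxBl. Qed.

Lemma orthproj_sqr nu v : enorm nu = 1 ->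
  dot (orthproj nu v) (orthproj nu v) = dot v v - dot v nu ^+ 2.
Proof.
move=> nu1; rewrite {2}/orthproj dotBr dotZr dot_orthproj// mulr0 subr0.
by rewrite dotBl dotZl (dotC nu) expr2.
Qed.

Lemma enorm_orthproj nu v : enorm nu = 1 -> enorm (orthproj nu v) <= enorm v.
Proof.
move=> nu1; rewrite -(@ler_pXn2r _ 2)// ?nnegrE ?enorm_ge0//.
by rewrite !sqr_enorm orthproj_sqr// gerBl sqr_ge0.
Qed.

End NormalLine.

Section Tilt.
Context {R : realType} {n : nat} {M : manifold R n} {F : M -> 'rV[R]_n.+1}.
Hypothesis F_imm : immersion F.
Notation Xof c := (F \o cinv c).

Lemma tangent_space_charts c d x y (xi : 'rV[R]_n) : atlas c -> atlas d ->
  ccod c x -> ccod d y -> cinv c x = cinv d y ->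
  exists xi', xi *m jac (Xof d) y = xi' *m jac (Xof c) x.
Proof.
move=> Ac Ad Ux Uy xy.
have [sm _] := atlas_compatible Ad Ac 1%N.
have Vy : (ccod d `&` cinv d @^-1` cdom c) y.
  by split=> //=; rewrite -xy; exact: cinv_dom.
have tauy : (cmap c \o cinv d) y = x by rewrite /= -xy cinvK.
have dtau := sm _ Vy.
have dXx := chart_differentiable F_imm c Ac _ Ux.
have dXy := chart_differentiable F_imm d Ad _ Uy.
have y0 : y + (0 : R) *: xi = y by rewrite scale0r addr0.
exists (xi *m 'J (cmap c \o cinv d) y).
have d1 : is_derive (0 : R) 1 (fun s : R => Xof d (y + s *: xi)) (xi *m jac (Xof d) y).
  have := is_derive_comp_line (Xof d) y xi 0; rewrite y0 -jacobianE//; exact.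
have d2 : is_derive (0 : R) 1 (fun s : R => Xof c ((cmap c \o cinv d) (y + s *: xi)))
    (xi *m 'J (cmap c \o cinv d) y *m jac (Xof c) x).
  have := is_derive_comp_line (cmap c \o cinv d) y xi 0; rewrite y0 => /(_ dtau) dl.
  have := is_derive_comp_diff (Xof c) _ 0 _ dl; rewrite y0 tauy -jacobianE//; exact.
have near0 : \forall s \near (0 : R),
    Xof c ((cmap c \o cinv d) (y + s *: xi)) = Xof d (y + s *: xi).
  have : \forall s \near (0 : R), cdom c (cinv d (y + s *: xi)).
    have lc := line_continuous y xi 0.
    have cc : {for y + 0 *: xi, continuous (cinv d)}.
      by rewrite y0; exact: cinv_continuous.
    apply: (@cvg_comp _ _ _ (fun s : R => y + s *: xi) (cinv d) _ _ _ lc cc).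
    rewrite y0; apply: open_nbhs_nbhs; split; last by case: Vy.
    exact: cdom_open.
  by apply: filterS => s cs /=; rewrite cmapK.
have [_ <-] := d1; have [_ <-] := near_eq_is_derive near0 d2.
by [].
Qed.

Definition tilt_le nu p (beta : R) : Prop := forall c x, atlas c -> ccod c x ->
  cinv c x = p ->
  dot (tangent_part (jac (Xof c) x) nu) (tangent_part (jac (Xof c) x) nu) <= beta.

Lemma tilt_le_chart nu c x beta : atlas c -> ccod c x ->
  dot (tangent_part (jac (Xof c) x) nu) (tangent_part (jac (Xof c) x) nu) <= beta ->
  tilt_le nu (cinv c x) beta.
Proof.
move=> Ac Ux xb d y Ad Uy yx; apply: le_trans xb.
have [xi' xiE] := tangent_space_charts c d x y (tangent_coord (jac (Xof d) y) nu)
  Ac Ad Ux Uy (esym yx).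
rewrite -tangent_part_eq; last exact: chart_row_free.
have -> : tangent_part (jac (Xof d) y) nu = xi' *m jac (Xof c) x by exact: xiE.
by apply: tangent_part_le; exact: chart_row_free.
Qed.

Lemma tilt_chain nu (K beta : R) p q l : enorm nu = 1 -> 0 <= K ->
  (forall c x, atlas c -> ccod c x -> second_form_sqnorm (Xof c) x <= K ^+ 2) ->
  chain F p q l -> tilt_le nu p beta -> tilt_le nu q (beta + 2 * K * l).
Proof.
move=> nu1 K0 AK pq; elim: pq beta => [{}p {}l l0|c x v l1 {}q m Ac seg _ ih] beta pb.
  move=> c x Ac Ux xp; apply: (le_trans (pb _ _ Ac Ux xp)).
  by rewrite lerDl !mulr_ge0.
have Ux := segment_cost_start _ _ _ _ seg.
have Uxv := segment_cost_end _ _ _ _ seg.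
rewrite mulrDr addrA; apply: ih; apply: tilt_le_chart => //.
have step := tilt_segment (chart_differentiable F_imm c Ac)
  (chart_partial_differentiable F_imm c Ac) (chart_row_free F_imm c Ac)
  nu K l1 x v nu1 K0 (fun y => AK c y Ac) seg.
apply: le_trans step _.
by rewrite lerD2r; exact: pb.
Qed.

End Tilt.

Section LocalProjection.
Context {R : realType} {n : nat} {M : manifold R n} {F : M -> 'rV[R]_n.+1}.
Hypothesis F_imm : immersion F.
Notation Xof c := (F \o cinv c).
Context {nu : 'rV[R]_n.+1}.
Hypothesis nu1 : enorm nu = 1.

Lemma slope_estimate q b : tilt_le (F := F) nu q (1 / 16) -> dot b nu = 0 ->
  orthproj nu (F q) != b ->
  exists y l, [/\ 0 < l, chain F q y l &
    enorm (orthproj nu (F y) - b) <= enorm (orthproj nu (F q) - b) - 9 / 10 * l].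
Proof.
move=> qt bnu qb; have [c Ac cq] := atlas_cover q.
have U0 := cmap_cod cq; move: (cmapK cq) U0; set x := cmap c q => xq U0.
have Jfree := chart_row_free F_imm c Ac x U0.
have psi := qt c x Ac U0 xq.
pose v := orthproj nu (F q) - b; pose V := enorm v.
have v0 : v != 0 by rewrite subr_eq0.
have V0 : 0 < V by exact: enorm_gt0.
have [e [vE e1 enu]] : exists e, [/\ v = V *: e, enorm e = 1 & dot e nu = 0].
  exists (V^-1 *: v); split; first by rewrite scalerA mulfV ?scale1r// gt_eqF.
    exact: enorm_unit.
  by rewrite dotZl dotBl dot_orthproj// bnu subrr mulr0.
have Te := tangent_part_orthogonal_ge _ e nu Jfree e1 nu1 enu.
set J := jac (Xof c) x in Jfree psi Te.
pose T := tangent_part J e; pose s := enorm T; pose xi := tangent_coord J e.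
have sT : dot T T = s ^+ 2 by rewrite sqr_enorm.
have s0 : 0 <= s by exact: enorm_ge0.
have s1 : s <= 1 by rewrite -e1; exact: enorm_tangent_part.
have s2 : 15 / 16 <= s ^+ 2 by rewrite -sT; apply: le_trans Te; lra.
pose eta := (100 * (1 + `|xi|))^-1.
have xi0 : 0 < 1 + `|xi| by rewrite ltr_pwDl.
have eta0 : 0 < eta by rewrite invr_gt0 mulr_gt0.
have etaxi : eta * `|xi| <= 1 / 100.
  rewrite /eta invfM -mulrA mulrC mul1r ler_piMl ?invr_ge0//.
  by rewrite mulrC ler_pdivrMr// mul1r lerDr.
have [rho rho0 [rU rJ rX]] := strict_differentiability (@ccod_open _ _ _ c)
  (chart_differentiable F_imm c Ac) (chart_partial_continuous F_imm c Ac) x eta U0 eta0.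
pose t := Num.min (rho / (1 + `|xi|)) (V / 100).
have t0 : 0 < t by rewrite lt_min !divr_gt0.
have tV : t <= V / 100 by rewrite ge_min lexx orbT.
have txi : t * `|xi| < rho.
  have : t <= rho / (1 + `|xi|) by rewrite ge_min lexx.
  rewrite ler_pdivlMr// mulrDr mulr1; lra.
have near_x (a : R) : 0 <= a <= 1 -> `|x + a *: (- t *: xi) - x| < rho.
  move=> /andP[a0 a1]; rewrite addrC addKr !normrZ normrN (gtr0_norm t0) ger0_norm//.
  apply: le_lt_trans txi; rewrite ler_piMl// mulr_ge0// ltW//.
have x_end : x + - t *: xi = x + 1 *: (- t *: xi) by rewrite scale1r.
have xr : `|x - x| < rho by rewrite subrr normr0.
have yr : `|x + - t *: xi - x| < rho by rewrite x_end near_x// ler01 lexx.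
exists (cinv c (x + - t *: xi)), (t * (s + 1 / 100)); split.
- by rewrite mulr_gt0//; lra.
- rewrite -xq; apply: chain_segment => // a aI; have xar := near_x a aI.
  split; first exact: rU.
  rewrite -scalemxAl enormZ normrN gtr0_norm// ler_wpM2l ?(ltW t0)//.
  have := rJ _ xi xar.
  have := enormB (xi *m jac (Xof c) (x + a *: (- t *: xi))) (xi *m J).
  rewrite -/J -[xi *m J]/(tangent_part J e) -/T -/s; lra.
have Fq : F q = Xof c x by rewrite /= xq.
pose err := Xof c (x + - t *: xi) - Xof c x - (- t *: xi) *m J.
have err_le : enorm err <= t * (1 / 100).
  have yx : x + - t *: xi - x = - t *: xi by rewrite addrC addKr.
  have rXy := rX _ _ xr yr; rewrite yx in rXy; apply: (le_trans rXy).
  rewrite normrZ normrN (gtr0_norm t0) mulrCA ler_wpM2l//.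
  exact: ltW.
have -> : orthproj nu (F (cinv c (x + - t *: xi))) - b =
    (v - t *: orthproj nu T) + orthproj nu err.
  rewrite /err /v Fq -scalemxAl -[xi *m J]/(tangent_part J e) -/T.
  have lin : orthproj nu (- t *: T) = - (t *: orthproj nu T).
    by rewrite !orthprojE -scalemxAl scaleNr.
  rewrite !orthprojB lin.
  by apply/rowP => i; rewrite !mxE; ring.
have main : enorm (v - t *: orthproj nu T) <= V - (s ^+ 2 - 1 / 100) * t.
  have eT : dot e (orthproj nu T) = s ^+ 2.
    rewrite /orthproj dotBr dotZr enu mulr0 subr0.
    by rewrite /T dot_tangent_part.
  have PT : dot (orthproj nu T) (orthproj nu T) <= s ^+ 2.
    by rewrite orthproj_sqr// sT gerBl sqr_ge0.
  have ss1 : s ^+ 2 <= 1 by rewrite expr_le1.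
  have Vt : 0 <= V - (s ^+ 2 - 1 / 100) * t by nra.
  rewrite -(@ler_pXn2r _ 2)// ?nnegrE ?enorm_ge0//.
  rewrite sqr_enorm vE dotBl !dotBr !dotZl !dotZr -(sqr_enorm e) e1.
  rewrite (dotC (orthproj nu T) e) eT.
  by move: (dot _ _) PT => w; nra.
rewrite -/V; apply: (le_trans (enormD _ _)).
have perr : enorm (orthproj nu err) <= t * (1 / 100).
  by rewrite (le_trans (enorm_orthproj _ _ _)).
rewrite -/v -/V; nra.
Qed.

Lemma proj_locally_injective q : tilt_le (F := F) nu q (1 / 16) ->
  exists2 e : R, 0 < e & forall z y, chain F z q e -> chain F y q e ->
    orthproj nu (F z) = orthproj nu (F y) -> z = y.
Proof.
move=> qt; have [c Ac cq] := atlas_cover q.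
have U0 := cmap_cod cq; move: (cmapK cq) U0; set x := cmap c q => xq U0.
have Jfree := chart_row_free F_imm c Ac x U0.
have psi := qt c x Ac U0 xq.
set J := jac (Xof c) x in Jfree psi.
have [k k0 hk] := row_free_lower_bound J Jfree.
have k20 : 0 < k / 2 by lra.
have lower (xi : 'rV[R]_n) : k / 2 * `|xi| <= enorm (xi *m J *m (1%:M - nu^T *m nu)).
  rewrite -orthprojE; set w := xi *m J.
  have h : enorm w / 2 <= enorm (orthproj nu w).
    rewrite -(@ler_pXn2r _ 2)// ?nnegrE ?enorm_ge0//; last first.
      by rewrite divr_ge0 ?enorm_ge0.
    rewrite [leRHS]sqr_enorm orthproj_sqr//.
    have wnu : dot w nu = dot w (tangent_part J nu).
      have := tangent_part_orth J nu xi Jfree; rewrite dotBl => /subr0_eq.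
      by rewrite (dotC nu) (dotC (tangent_part J nu)).
    have : dot w nu ^+ 2 <= dot w w * (1 / 16).
      rewrite wnu -[leLHS]real_normK ?num_real//.
      apply: (@le_trans _ _ ((enorm w * enorm (tangent_part J nu)) ^+ 2)).
        by rewrite ler_pXn2r// ?nnegrE ?mulr_ge0 ?enorm_ge0// normr_dot_le.
      by rewrite exprMn !sqr_enorm ler_wpM2l// dot_ge0.
    have := dot_ge0 w; rewrite expr_div_n sqr_enorm; lra.
  apply: le_trans h; have := hk xi; rewrite -/w; lra.
have [r r0 [rU rX]] := local_expansion (@ccod_open _ _ _ c)
  (chart_differentiable F_imm c Ac) (chart_partial_continuous F_imm c Ac) _ _ x
  _ U0 k20 lower.
have [rho [B [kap [rho0 B0 kap0 [_ _ hN]]]]] := chart_neighbourhood F_imm c x Ac U0.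
rewrite xq in hN.
pose e := Num.min (kap * rho) (kap * r) / 2.
have m0 : 0 < Num.min (kap * rho) (kap * r) by rewrite lt_min !mulr_gt0.
have e0 : 0 < e by rewrite divr_gt0.
have em : e < Num.min (kap * rho) (kap * r) by rewrite /e; lra.
have near_q z : chain F z q e -> exists2 xz, z = cinv c xz & `|xz - x| < r.
  move=> /(chain_path F_imm)[l' zq le'].
  have : l' < Num.min (kap * rho) (kap * r) by exact: le_lt_trans em.
  rewrite lt_min => /andP[lrho lr].
  have [xz [zE _ xzl]] := hN z l' zq lrho.
  by exists xz => //; rewrite -(ltr_pM2l kap0); exact: le_lt_trans lr.
exists e => // z y /near_q[xz -> xzr] /near_q[xy -> xyr].
rewrite !orthprojE => zy.
have := rX _ _ xzr xyr; rewrite mulmxBl /= -zy subrr enorm0.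
rewrite pmulr_rle0; last by lra.
by rewrite normr_le0 subr_eq0 => /eqP ->.
Qed.

End LocalProjection.

Lemma sup_sqnorm_A_bound {R : realType} {n : nat} {M : manifold R n}
    {F : M -> 'rV[R]_n.+1} : (sup_sqnorm_A F < +oo)%E ->
  exists2 K : R, 0 <= K & forall c x, atlas c -> ccod c x ->
    second_form_sqnorm (F \o cinv c) x <= K ^+ 2.
Proof.
move=> Aoo; exists (1 + `|fine (sup_sqnorm_A F)|); first by rewrite addr_ge0.
move=> c x Ac Ux.
have : ((second_form_sqnorm (F \o cinv c) x)%:E <= sup_sqnorm_A F)%E.
  by apply: ereal_sup_ubound; exists c, x.
move: (second_form_sqnorm _ _) => a.
case: (sup_sqnorm_A F) Aoo => [s _|//|//]; rewrite lee_fin /= => as_.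
have := ler_norm s; have := normr_ge0 s; nra.
Qed.

Theorem theorem3 (R : realType) (n : nat) (M : manifold R n)
    (F : M -> 'rV[R]_n.+1)
    (n_ge2 : (2 <= n)%N)
    (M_nonempty : [set: M] !=set0)
    (F_embedded : embedded_hypersurface F)
    (F_complete : complete_hypersurface F)
    (F_minimal : minimal F)
    (A_bounded : (sup_sqnorm_A F < +oo)%E) :
  forall (a : 'rV[R]_n.+1) (r : R), ~ (range F `<=` eball a r).
Proof.
move=> a r Fball; have [F_imm _] := F_embedded.
have CL := chain_complete F_imm F_complete.
have [K K0 AK] := sup_sqnorm_A_bound A_bounded.
pose r0 : R := (32 * (K + 1))^-1.
have r00 : 0 < r0 by rewrite invr_gt0 mulr_gt0// ltr_wpDl.
have Kr0 : 2 * K * r0 <= 1 / 16.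
  have K1 : 0 < K + 1 by rewrite ltr_wpDl.
  by rewrite /r0 ler_pdivrMr ?mulr_gt0//; lra.
pose D p := dot (F p - a) (F p - a).
have supD : has_sup (range D).
  have [p _] := M_nonempty; split; first by exists (D p), p.
  exists (r ^+ 2) => _ [q _ <-]; rewrite /D -sqr_enorm.
  have : enorm (F q - a) < r by apply: Fball; exists q.
  move=> qr; rewrite ler_pXn2r// ?nnegrE ?enorm_ge0 ?ltW//.
  exact: le_lt_trans (enorm_ge0 _) qr.
pose rho := r0 / 64.
have rho0 : 0 < rho by rewrite /rho; lra.
have rho2 : 0 < rho ^+ 2 / 2 by rewrite divr_gt0// exprn_gt0.
have [_ [p0 _ <-] p0sup] := sup_adherent rho2 supD.
have [c0 Ac0 cp0] := atlas_cover p0.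
have [nu nu1 nuJ] := exists_unit_normal (jac (F \o cinv c0) (cmap c0 p0)).
have p0t : tilt_le (F := F) nu p0 0.
  rewrite -(cmapK cp0); apply: (tilt_le_chart F_imm) => //; first exact: cmap_cod.
  by rewrite /tangent_part /tangent_coord nuJ !mul0mx dot0l.
have ball_tilt q b : chain F p0 q b -> b < r0 -> tilt_le (F := F) nu q (1 / 16).
  move=> p0q br0 c x Ac Ux xq.
  apply: le_trans (tilt_chain F_imm nu K 0 _ _ _ nu1 K0 AK p0q p0t c x Ac Ux xq) _.
  rewrite add0r; apply: le_trans Kr0; rewrite ler_wpM2l ?mulr_ge0//; exact: ltW.
pose f p := orthproj nu (F p).
pose W : set 'rV[R]_n.+1 := [set b | dot b nu = 0].
pose Phi (u : 'rV[R]_n.+1) := enorm (u - a) ^+ 2 - enorm (u - F p0) ^+ 2 / 2.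
have f_lip x y l : chain F x y l -> enorm (f x - f y) <= l.
  move=> /(chain_lipschitz F_imm) xy; rewrite /f -orthprojB.
  exact: le_trans (enorm_orthproj _ _ nu1) xy.
have fW x : W (f x) by exact: dot_orthproj.
have Wclosed : closed W.
  have /continuous_closedP := dotl_continuous nu.
  by move=> /(_ _ (@closed_eq _ 0)).
have Phi_cont : continuous Phi.
  move=> u; rewrite /Phi.
  have ca := enormB_continuous a u; have cp := enormB_continuous (F p0) u.
  apply: (@cvgB _ _ _ (nbhs u) (nbhs_filter u)).
    by apply: (@cvgM _ _ _ (nbhs_filter u)).
  apply: (@cvgM _ _ _ (nbhs_filter u)); last exact: cvg_cst.
  by apply: (@cvgM _ _ _ (nbhs_filter u)).
have [q [p0q qrho qmax]] := compact_maximum CL f_lip fW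
  (fun q b' b p0q br0 Wb => slope_estimate F_imm nu1 q b (ball_tilt q b' p0q br0) Wb)
  (fun q b p0q br0 => proj_locally_injective F_imm nu1 q (ball_tilt q b p0q br0))
  _ F Phi (fun x y l => chain_lipschitz F_imm x y l) Phi_cont Wclosed r00.
have q_int : enorm (f q - f p0) < rho.
  have Fq : enorm (f q - f p0) <= enorm (F q - F p0).
    by rewrite /f -orthprojB enorm_orthproj.
  have := qmax p0 (ltac:(apply: chain_nil; lra)) (ltac:(rewrite subrr enorm0; lra)).
  rewrite /Phi subrr enorm0 expr0n mul0r subr0 !sqr_enorm -/(D p0) -/(D q).
  have Dq : D q <= sup (range D) by apply: sup_upper_bound => //; exists q.
  rewrite -sqr_enorm => pq.
  have : enorm (F q - F p0) ^+ 2 < rho ^+ 2 by lra.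
  rewrite ltr_pXn2r// ?nnegrE ?enorm_ge0 ?(ltW rho0)//; exact: le_lt_trans.
have [c Ac cq] := atlas_cover q.
have U0 := cmap_cod cq.
have [r1 [B [kap [r10 B0 _ [r1U r1B _]]]]] := chart_neighbourhood F_imm c _ Ac U0.
pose gap := Num.min (r0 / 100) (rho - enorm (f q - f p0)).
have gap0 : 0 < gap by rewrite lt_min subr_gt0 q_int andbT; lra.
pose d := Num.min r1 (gap / B).
have d0 : 0 < d by rewrite lt_min r10 divr_gt0.
apply: (no_local_max (chart_differentiable F_imm c Ac)
  (chart_partial_differentiable F_imm c Ac) (chart_row_free F_imm c Ac)
  a (F p0) (cmap c q) d) => //.
- exact: ltnW.
- by move=> y; rewrite lt_min => /andP[/r1U].
- exact: F_minimal.
move=> y; rewrite lt_min => /andP[yr1 yd].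
have qy := r1B (cmap c q) y (ltac:(by rewrite subrr normr0)) yr1.
rewrite cmapK// in qy.
have ygap : B * `|y - cmap c q| <= gap.
  by rewrite mulrC -ler_pdivlMr// ltW.
have [yg1 yg2] : B * `|y - cmap c q| <= r0 / 100 /\
    B * `|y - cmap c q| <= rho - enorm (f q - f p0).
  by split; apply: le_trans ygap _; rewrite ge_min lexx ?orbT.
have := qmax (cinv c y) _ _; rewrite /Phi !sqr_enorm /= cmapK//; apply.
  by apply: chain_le (chain_trans _ _ _ _ _ p0q qy) _; lra.
apply: (le_trans (enorm_triangle (f q) _ _)).
have := f_lip _ _ _ qy; rewrite (enormBC (f q)) -/rho; lra.
Qed.
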